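(* Let $G=\mathrm{SL}_2(\mathbb{C})\times\mathrm{SL}_2(\mathbb{C})\times\mathrm{SL}_2(\mathbb{C})$ and let $H=\mathrm{SL}_2(\mathbb{C})_{\mathrm{diag}}\subset G$ be the diagonal subgroup (the space $G/H$ of hyperbolic triangles). As $t\to0$ the images $\mathrm{sLog}_t(G/H)\subset\mathbb{R}^3$ of the spherical logarithm map converge in the sense of Kuratowski to the (real) valuation cone of $G/H$, which in the given coordinates is the cone in $\mathbb{R}^3$ generated by $(-1,-1,0)$, $(-1,0,-1)$ and $(0,-1,-1)$.
   Context: Choose in $G$ the Borel subgroup $B_G=B^-\times B^-\times B^-$ ($B^-$ = lower triangular matrices in $\mathrm{SL}_2(\mathbb{C})$) and $K=\mathrm{SU}_2\times\mathrm{SU}_2\times\mathrm{SU}_2$. $G$ acts on functions on $G/H$ by $(g\cdot f)(x)=f(g^{-1}x)$. Let $\omega_i$ be the pullback to $B_G$ of the fundamental weight of $\mathrm{SL}_2(\mathbb{C})$ via the $i$-th factor and $\Omega_{ij}=\omega_i+\omega_j$. $G/H$ is an affine spherical homogeneous space and the semigroup of highest weights of the multiplicity-free $G$-module $\mathbb{C}[G/H]$ is generated by $\Omega_{12},\Omega_{13},\Omega_{23}$. The highest weight vector of weight $\Omega_{ij}$ is the determinant of the $2\times2$ matrix whose rows are the top rows of the $i$-th and $j$-th matrices of a triple in $G$. Spherical functions: for a highest weight $\lambda$, let $V_\lambda\subset\mathbb{C}[G/H]$ be the irreducible submodule of highest weight $\lambda$ and $\{f_i\}$ an orthonormal basis of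 $V_\lambda$ for a $K$-invariant Hermitian product; $\phi_\lambda(x)$ is $\sum_i|f_i(x)|^2$ rescaled by a positive constant so that $\phi_\lambda(eH)=1$. Concretely, $\phi_{\Omega_{ij}}$ at the class of $(A_1,A_2,A_3)$ is $\tfrac12$ times the sum of the squared absolute values of the four $2\times2$ determinants formed from one row of $A_i$ and one row of $A_j$. The spherical logarithm is $\mathrm{sLog}_t=(\log_t\phi_{\Omega_{12}},\log_t\phi_{\Omega_{13}},\log_t\phi_{\Omega_{23}}):G/H\to\mathbb{R}^3$, with $\log_t(y)=\ln y/\ln t$, $0<t<1$. The valuation cone is the set of $G$-invariant discrete $\mathbb{Q}$-valued valuations $v$ of $\mathbb{C}(G/H)$, trivial on $\mathbb{C}^*$, embedded in $\mathbb{Q}^3$ by $v\mapsto(v(f_{12}),v(f_{13}),v(f_{23}))$ with $f_{ij}$ the highest weight vector of weight $\Omega_{ij}$; the real valuation cone is its Euclidean closure in $\mathbb{R}^3$. Kuratowski convergence of $X_t\subset\mathbb{R}^3$ to $X_0\subset\mathbb{R}^3$ as $t\to0^+$: (a) every $y\notin X_0$ has a neighbourhood $U$ and $\varepsilon>0$ with $X_t\cap U=\emptyset$ for $0<t<\varepsilon$; (b) for every $y\in X_0$ and every neighbourhood $U$ of $y$ there is $\varepsilon>0$ with $X_t\cap U\neq\emptyset$ for $0<t<\varepsilon$. *)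

(* Defs.v *)
From HB Require Import structures.
From mathcomp Require Import all_boot all_order all_algebra.
From mathcomp Require Import fraction generic_quotient complex.
From mathcomp Require Import boolp classical_sets functions reals.
From mathcomp Require Import topology normedtype exp.
From mathcomp Require Import ring.

Set Implicit Arguments.
Unset Strict Implicit.
Unset Printing Implicit Defensive.

Import Order.TTheory GRing.Theory Num.Theory numFieldNormedType.Exports.

Local Open Scope ring_scope.
Local Open Scope complex_scope.
Local Open Scope quotient_scope.
Local Open Scope classical_set_scope.

Section Groups.
Variable R : realType.

Record SL2 := MkSL2 { SL2val :> 'M[R[i]]_2; _ : \det SL2val == 1 }.

HB.instance Definition _ := [isSub for SL2val].
HB.instance Definition _ := [Choice of SL2 by <:].

Lemma SL2P (A : SL2) : \det A = 1.
Proof. by case: A => A /= /eqP. Qed.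

Lemma SL2unit (A : SL2) : SL2val A \in unitmx.
Proof. by rewrite unitmxE SL2P unitr1. Qed.

Fact SL2one_subproof : \det (1%:M : 'M[R[i]]_2) == 1.
Proof. by rewrite det1. Qed.

Fact SL2mul_subproof (A B : SL2) : \det (A *m B) == 1.
Proof. by rewrite det_mulmx !SL2P mulr1. Qed.

Fact SL2inv_subproof (A : SL2) : \det (invmx A) == 1.
Proof. by rewrite det_inv SL2P invr1. Qed.

Definition SL2one := MkSL2 SL2one_subproof.
Definition SL2mul (A B : SL2) := MkSL2 (SL2mul_subproof A B).
Definition SL2inv (A : SL2) := MkSL2 (SL2inv_subproof A).

Fact SL2mulA : associative SL2mul.
Proof. by move=> A B D; apply: val_inj; rewrite /= mulmxA. Qed.
Fact SL2mul1 : left_id SL2one SL2mul.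
Proof. by move=> A; apply: val_inj; rewrite /= mul1mx. Qed.
Fact SL2mulr1 : right_id SL2one SL2mul.
Proof. by move=> A; apply: val_inj; rewrite /= mulmx1. Qed.
Fact SL2mulV : left_inverse SL2one SL2inv SL2mul.
Proof. by move=> A; apply: val_inj; rewrite /= mulVmx ?SL2unit. Qed.
Fact SL2mulrV : right_inverse SL2one SL2inv SL2mul.
Proof. by move=> A; apply: val_inj; rewrite /= mulmxV ?SL2unit. Qed.

HB.instance Definition _ :=
  isGroup.Build SL2 SL2mulA SL2mul1 SL2mulr1 SL2mulV SL2mulrV.

Definition G := {ffun 'I_3 -> SL2}.
HB.instance Definition _ := Group.on G.

Definition diagG (h : SL2) : G := [ffun=> h].

Definition coset_rel (x y : G) : bool := `[< exists h, y = (x * diagG h)%g >].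

Lemma diagGM h k : diagG (h * k)%g = (diagG h * diagG k)%g.
Proof. by apply/ffunP => i; rewrite !ffunE. Qed.

Lemma diagG1 : diagG 1%g = 1%g.
Proof. by apply/ffunP => i; rewrite !ffunE. Qed.

Fact coset_rel_refl : reflexive coset_rel.
Proof. by move=> x; apply/asboolP; exists 1%g; rewrite diagG1 mulg1. Qed.

Fact coset_rel_sym : symmetric coset_rel.
Proof.
suff imp x y : coset_rel x y -> coset_rel y x by move=> x y; apply/idP/idP; apply: imp.
move=> /asboolP[h ->]; apply/asboolP; exists h^-1%g.
by rewrite -mulgA -diagGM mulgV diagG1 mulg1.
Qed.

Fact coset_rel_trans : transitive coset_rel.
Proof.
move=> y x z /asboolP[h ->] /asboolP[k ->]; apply/asboolP.
by exists (h * k)%g; rewrite diagGM mulgA.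
Qed.

Canonical coset_equiv :=
  EquivRel coset_rel coset_rel_refl coset_rel_sym coset_rel_trans.

Definition GH := {eq_quot coset_rel}.
HB.instance Definition _ : EqQuotient _ coset_rel GH := EqQuotient.on GH.
HB.instance Definition _ := Choice.on GH.

Definition piGH (x : G) : GH := \pi_GH x.

Definition transl (g : G) (x : GH) : GH := piGH (g * repr x)%g.

Lemma piGH_eq (x y : G) : piGH x = piGH y <-> exists h, y = (x * diagG h)%g.
Proof.
split=> [/eqP|h]; first by rewrite /piGH eqmodE => /asboolP.
by apply/eqP; rewrite /piGH eqmodE; apply/asboolP.
Qed.

Lemma translE g x : transl g (piGH x) = piGH (g * x)%g.
Proof.
have /piGH_eq[h e] : piGH (repr (piGH x)) = piGH x by rewrite /piGH reprK.
by apply/piGH_eq; exists h; rewrite -mulgA -e.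
Qed.

End Groups.

Section CoordinateRing.
Variable R : realType.
Local Notation C := R[i].
Local Notation G := (G R).
Local Notation GH := (GH R).

(* C[G]: the algebra of functions on G generated by the matrix entries. *)
Inductive polynomialG : (G -> C) -> Prop :=
| poly_cst c : polynomialG (fun=> c)
| poly_entry k i j : polynomialG (fun g => SL2val (g k) i j)
| poly_add f f' : polynomialG f -> polynomialG f' ->
    polynomialG (fun g => f g + f' g)
| poly_mul f f' : polynomialG f -> polynomialG f' ->
    polynomialG (fun g => f g * f' g).

(* C[G/H] is the algebra of functions on G/H whose pullback to G is regular,
   i.e. C[G]^H. *)
Definition regular_fun (f : GH -> C) : bool :=
  `[< polynomialG (fun g => f (piGH g)) >].

Record coordRing := MkCoordRing { coord_fun :> GH -> C; _ : regular_fun coord_fun }.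

HB.instance Definition _ := [isSub for coord_fun].
HB.instance Definition _ := [Choice of coordRing by <:].

Lemma coordP (f : coordRing) : polynomialG (fun g => f (piGH g)).
Proof. by case: f => f /= /asboolP. Qed.

Fact regular_subring : subring_closed regular_fun.
Proof.
split.
- by apply/asboolP; exact: poly_cst.
- move=> f f' /asboolP Rf /asboolP Rf'; apply/asboolP.
  have -> : (fun g => (f - f') (piGH g)) =
            (fun g => f (piGH g) + (- 1) * f' (piGH g)).
    by apply/funext => g; rewrite mulN1r.
  by apply: poly_add => //; apply: poly_mul => //; exact: poly_cst.
- by move=> f f' /asboolP Rf /asboolP Rf'; apply/asboolP; exact: poly_mul.
Qed.

Fact regular_submod : subsemimod_closed regular_fun.
Proof.
split.
  split.
    by apply/asboolP; exact: poly_cst.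
  by move=> f f' /asboolP Rf /asboolP Rf'; apply/asboolP; exact: poly_add.
by move=> c f /asboolP Rf; apply/asboolP; apply: poly_mul => //; exact: poly_cst.
Qed.

HB.instance Definition _ :=
  GRing.SubChoice_isSubComPzRing.Build _ _ coordRing regular_subring.
HB.instance Definition _ :=
  GRing.SubZmodule_isSubLmodule.Build _ _ _ coordRing regular_submod.

Fact coord_oner_neq0 : 1 != 0 :> coordRing.
Proof.
apply/eqP => /(congr1 (fun f : coordRing => f (piGH 1%g))) /eqP.
by rewrite (oner_eq0 C).
Qed.

HB.instance Definition _ :=
  GRing.PzSemiRing_isNonZero.Build coordRing coord_oner_neq0.

Lemma coord_ext (f f' : coordRing) : (forall g, f (piGH g) = f' (piGH g)) -> f = f'.
Proof.
by move=> e; apply: val_inj; apply/funext => x; have := e (repr x);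
  rewrite /piGH reprK.
Qed.

Fact coord_scaleAl (c : C) (f f' : coordRing) : c *: (f * f') = c *: f * f'.
Proof. by apply: coord_ext => g; exact: mulrA. Qed.

HB.instance Definition _ :=
  GRing.Lmodule_isLalgebra.Build C coordRing coord_scaleAl.

End CoordinateRing.

(* C[G/H] has no zero divisors: a polynomial curve joins any two points of G,
   because every matrix of SL_2(C) is a product of four elementary matrices. *)
Section Integrality.
Variable R : realType.
Local Notation C := R[i].
Local Notation G := (G R).

Lemma det_mx22 (S : comNzRingType) (A : 'M[S]_2) :
  \det A = A 0 0 * A 1 1 - A 0 1 * A 1 0.
Proof.
rewrite (expand_det_row A 0) !big_ord_recl big_ord0 /cofactor !det_mx11 !mxE /=.
rewrite expr0 mul1r expr1 mulN1r addr0 mulrN; congr (A _ _ * A _ _ - A _ _ * A _ _);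
  exact: val_inj.
Qed.

Definition elem4 (S : comNzRingType) (x y z w : S) : 'M[S]_2 :=
  \matrix_(i < 2, j < 2)
    if i == 0 then
      if j == 0 then 1 + x * y + ((1 + x * y) * z + x) * w
      else (1 + x * y) * z + x
    else if j == 0 then y + (y * z + 1) * w else y * z + 1.

Fact elem4_subproof (x y z w : C) : \det (elem4 x y z w) == 1.
Proof. by apply/eqP; rewrite det_mx22 !mxE /=; ring. Qed.

Definition SL2elem (x y z w : C) : SL2 R := MkSL2 (elem4_subproof x y z w).

Lemma SL2elemP (A : SL2 R) : exists x y z w, A = SL2elem x y z w.
Proof.
have := SL2P A; rewrite det_mx22; set a := A 0 0; set b := A 0 1.
set c := A 1 0; set d := A 1 1 => detA.
pose w : C := if c == 0 then - 1 else 0.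
have y0 : c - d * w != 0.
  rewrite /w; case: (eqVneq c 0) => [c0|]; last by rewrite mulr0 subr0.
  rewrite c0 mulrN1 opprK add0r; apply/eqP => d0.
  by move/eqP: detA; rewrite c0 d0 !mulr0 subr0 eq_sym oner_eq0.
exists ((a - b * w - 1) / (c - d * w)), (c - d * w), ((d - 1) / (c - d * w)), w.
apply: val_inj; apply/matrixP => i j; rewrite /= !mxE.
have yV := divfK y0.
have a1 : 1 + (a - b * w - 1) / (c - d * w) * (c - d * w) = a - b * w.
  by rewrite yV; ring.
have b1 : (a - b * w) * ((d - 1) / (c - d * w)) + (a - b * w - 1) / (c - d * w)
          = b.
  apply: (mulIf y0); rewrite mulrDl -mulrA !yV.
  transitivity (a * d - b * c - 1 + b * (c - d * w)); first by ring.
  by rewrite detA subrr add0r.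
have d1 : (c - d * w) * ((d - 1) / (c - d * w)) + 1 = d.
  by rewrite mulrC yV subrK.
rewrite a1 b1 d1 !subrK.
by case: i => [[|[|//]] ?]; case: j => [[|[|//]] ?] /=;
  congr (SL2val A _ _); apply: val_inj.
Qed.

Lemma polynomialG_curve (x y z w x' y' z' w' : 'I_3 -> C) (F : G -> C) :
  polynomialG F -> exists p : {poly C}, forall s : C,
    F [ffun k => SL2elem (x k + s * x' k) (y k + s * y' k)
                         (z k + s * z' k) (w k + s * w' k)] = p.[s].
Proof.
elim=> [c|k i j|f f' _ [p hp] _ [p' hp']|f f' _ [p hp] _ [p' hp']].
- by exists c%:P => s; rewrite hornerC.
- pose l (u v : 'I_3 -> C) : {poly C} := (u k)%:P + 'X * (v k)%:P.
  exists (elem4 (l x x') (l y y') (l z z') (l w w') i j) => s.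
  rewrite ffunE /= !mxE /l.
  by case: (i == 0); case: (j == 0);
    rewrite !(hornerD, hornerM, hornerX, hornerC).
- by exists (p + p') => s; rewrite hp hp' hornerD.
- by exists (p * p') => s; rewrite hp hp' hornerM.
Qed.

Lemma poly_zero (p : {poly C}) : (forall s, p.[s] = 0) -> p = 0.
Proof.
move=> p0; apply/eqP; apply: contraT => pN0.
pose rs := [seq i%:R : C | i <- iota 0 (size p)].
have /(max_poly_roots pN0) : all (root p) rs by apply/allP => s _; apply/rootP.
rewrite map_inj_uniq ?iota_uniq; last by move=> i j /eqP; rewrite eqr_nat => /eqP.
by move=> /(_ isT); rewrite size_map size_iota ltnn.
Qed.

Fact coord_integral : forall f f' : coordRing R,
  f * f' = 0 -> (f == 0) || (f' == 0).
Proof.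
move=> f f' ff'0; apply: contraPT ff'0; rewrite negb_or => /andP[f0 f'0] ff'0.
have nz (h : coordRing R) : h != 0 -> exists g, h (piGH g) != 0.
  move=> h0; apply: contrapT => hN; move/eqP: h0; apply.
  apply: coord_ext => g; apply: contrapT => /eqP hg.
  by apply: hN; exists g.
have [g fg] := nz _ f0; have [g' f'g'] := nz _ f'0.
have [x hx] := choice (fun k => SL2elemP (g k)).
have [y hy] := choice hx; have [z hz] := choice hy; have [w hw] := choice hz.
have [x' hx'] := choice (fun k => SL2elemP (g' k)).
have [y' hy'] := choice hx'; have [z' hz'] := choice hy'.
have [w' hw'] := choice hz'.
have cv h (Ph : polynomialG h) := polynomialG_curve x y z w
  (fun k => x' k - x k) (fun k => y' k - y k) (fun k => z' k - z k)
  (fun k => w' k - w k) Ph.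
have [p hp] := cv _ (coordP f); have [p' hp'] := cv _ (coordP f').
have pN0 : p != 0.
  apply: contraNneq fg => p0; have := hp 0; rewrite p0 horner0 => <-.
  apply/eqP; congr (f (piGH _)); apply/ffunP => k; rewrite ffunE hw.
  by rewrite !mul0r !addr0.
have p'N0 : p' != 0.
  apply: contraNneq f'g' => p0; have := hp' 1; rewrite p0 horner0 => <-.
  apply/eqP; congr (f' (piGH _)); apply/ffunP => k; rewrite ffunE hw'.
  by rewrite !mul1r !(addrC _ (_ - _)) !subrK.
have /eqP : p * p' = 0.
  apply: poly_zero => s; rewrite hornerM -hp -hp'.
  exact: (congr1 (fun h : coordRing R => h (piGH _)) ff'0).
by rewrite mulf_eq0 (negPf pN0) (negPf p'N0).
Qed.

Definition coord_unit (f : coordRing R) : bool := `[< exists f', f' * f = 1 >].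
Definition coord_inv (f : coordRing R) : coordRing R :=
  xget f [set f' | f' * f = 1].

Fact coord_mulVf : {in coord_unit, left_inverse 1 coord_inv *%R}.
Proof. by move=> f /asboolP ex; exact: (xgetPex f ex). Qed.

Fact coord_unitP (f f' : coordRing R) : f' * f = 1 -> coord_unit f.
Proof. by move=> e; apply/asboolP; exists f'. Qed.

Fact coord_inv_out : {in [predC coord_unit], coord_inv =1 id}.
Proof.
move=> f /asboolPn nex; apply: xgetPN => f' e.
by apply: nex; exists f'.
Qed.

HB.instance Definition _ := GRing.ComNzRing_hasMulInverse.Build (coordRing R)
  coord_mulVf coord_unitP coord_inv_out.
HB.instance Definition _ :=
  GRing.ComUnitRing_isIntegral.Build (coordRing R) coord_integral.

End Integrality.

Local Notation "x %:F" := (FracField.tofrac x).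

Lemma frac_numden (A : idomainType) (x : {fraction A}) :
  x = (\n_(repr x))%:F / (\d_(repr x))%:F.
Proof.
rewrite -{1}[x]reprK; set r := repr x; have d0 := denom_ratioP r.
transitivity (\pi_{fraction A} (FracField.mulf (Ratio \n_r 1)
    (FracField.invf (Ratio \d_r 1)))).
  congr (\pi _); rewrite /FracField.mulf /FracField.invf.
  by rewrite !numden_Ratio ?oner_eq0 ?mul1r ?mulr1 ?Ratio_numden.
by rewrite !piE.
Qed.

Section Action.
Variable R : realType.
Local Notation C := R[i].
Local Notation G := (G R).
Local Notation GH := (GH R).
Local Notation A := (coordRing R).

Lemma polynomialG_transl (F : G -> C) (g : G) :
  polynomialG F -> polynomialG (fun x => F (g * x)%g).
Proof.
elim=> [c|k i j|f f' _ Pf _ Pf'|f f' _ Pf _ Pf'].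
- exact: poly_cst.
- have -> : (fun x : G => SL2val ((g * x)%g k) i j) =
      (fun x : G => SL2val (g k) i 0 * SL2val (x k) 0 j +
                    SL2val (g k) i 1 * SL2val (x k) 1 j).
    apply/funext => x; rewrite ffunE /= mxE !big_ord_recl big_ord0 addr0.
    by congr (_ + SL2val (g k) _ _ * SL2val (x k) _ _); apply: val_inj.
  by apply: poly_add; apply: poly_mul; (exact: poly_cst || exact: poly_entry).
- exact: poly_add.
- exact: poly_mul.
Qed.

Fact coord_act_subproof (g : G) (f : A) :
  regular_fun (fun x => f (transl g^-1%g x)).
Proof.
apply/asboolP.
have -> : (fun x => f (transl g^-1%g (piGH x))) =
          (fun x => f (piGH (g^-1 * x)%g)).
  by apply/funext => x; rewrite translE.
exact: (polynomialG_transl _ (coordP f)).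
Qed.

Definition coord_act (g : G) (f : A) : A :=
  MkCoordRing (coord_act_subproof g f).

(* C(G/H) is the fraction field of C[G/H] since G/H is affine. *)
Definition ratFun := {fraction A}.
HB.instance Definition _ := GRing.Field.on ratFun.

Definition frac_act (g : G) (x : ratFun) : ratFun :=
  (coord_act g \n_(repr x))%:F / (coord_act g \d_(repr x))%:F.

Lemma coord_actM g (f f' : A) :
  coord_act g (f * f') = coord_act g f * coord_act g f'.
Proof. by apply: coord_ext. Qed.

Lemma coord_act_eq0 g (f : A) : (coord_act g f == 0) = (f == 0).
Proof.
apply/eqP/eqP => [e|->]; apply: coord_ext => // x.
have := congr1 (fun h : A => h (piGH (g * x)%g)) e.
by rewrite /= translE mulgA mulVg mul1g.
Qed.

Lemma frac_actE g (a b : A) : b != 0 ->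
  frac_act g (a%:F / b%:F) = (coord_act g a)%:F / (coord_act g b)%:F.
Proof.
move=> b0; set x := a%:F / b%:F; rewrite /frac_act.
have d0 := denom_ratioP (repr x).
have tnz (h : A) : h != 0 -> h%:F != 0 by rewrite tofrac_eq0.
have xE : x = _ := frac_numden x.
have : a * \d_(repr x) = \n_(repr x) * b.
  apply/eqP; rewrite -tofrac_eq !tofracM.
  by rewrite -eqr_div ?tnz //; apply/eqP; exact: xE.
move=> /(congr1 (coord_act g)); rewrite !coord_actM => e.
apply/eqP; rewrite eqr_div ?tnz ?coord_act_eq0 // -!tofracM tofrac_eq.
by rewrite e.
Qed.

End Action.

Section SphericalFunctions.
Variable R : realType.
Local Notation C := R[i].
Local Notation G := (G R).
Local Notation GH := (GH R).
Local Notation A := (coordRing R).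

Definition borel : set G := [set b | forall k, SL2val (b k) 0 1 = 0].

Definition maxCompact : set G :=
  [set g | forall k, SL2val (g k) *m (map_mx conjc (SL2val (g k)))^T = 1%:M].

(* l stands for the weight l 0 * omega_0 + l 1 * omega_1 + l 2 * omega_2 *)
Definition weight := 'I_3 -> nat.

Definition Omega (i j : 'I_3) : weight := fun k => ((k == i) + (k == j))%N.

(* The root of the lower triangular Borel subgroup of SL_2(C) sends
   diag(t, 1/t) to t ^- 2, so its fundamental weight is the lower right entry. *)
Definition wchar (l : weight) (b : G) : C := \prod_k SL2val (b k) 1 1 ^+ l k.

Definition highest_weight_vector (l : weight) (f : A) : Prop :=
  f != 0 /\ forall b, borel b -> coord_act b f = wchar l b *: f.

Definition submodule (V : set A) : Prop :=
  [/\ V 0, forall (c : C) f f', V f -> V f' -> V (c *: f + f')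
    & forall g f, V f -> V (coord_act g f)].

Definition irreducible (V : set A) : Prop :=
  [/\ submodule V, V <> [set 0]
    & forall U, submodule U -> U `<=` V -> U = [set 0] \/ U = V].

Definition simple_submodule (l : weight) (V : set A) : Prop :=
  irreducible V /\ exists2 f, V f & highest_weight_vector l f.

Definition hermitian_product (V : set A) (h : A -> A -> C) : Prop :=
  [/\ forall (c : C) f f' e, V f -> V f' -> V e ->
        h (c *: f + f') e = c * h f e + h f' e,
      forall f e, V f -> V e -> h e f = conjc (h f e)
    & forall f, V f -> f != 0 -> 0 < h f f].

Definition K_invariant (V : set A) (h : A -> A -> C) : Prop :=
  forall k f e, maxCompact k -> V f -> V e ->
    h (coord_act k f) (coord_act k e) = h f e.

Definition orthonormal_basis (V : set A) (h : A -> A -> C)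
    (n : nat) (e : 'I_n -> A) : Prop :=
  [/\ forall i, V (e i), forall i j, h (e i) (e j) = (i == j)%:R
    & forall f, V f -> exists c : 'I_n -> C, f = \sum_i c i *: e i].

Definition is_spherical (l : weight) (phi : GH -> R) : Prop :=
  exists V h n (e : 'I_n -> A) (c : R),
    [/\ simple_submodule l V, hermitian_product V h, K_invariant V h,
        orthonormal_basis V h e
      & [/\ 0 < c, phi = (fun x => c * \sum_i Normc.normc (e i x) ^+ 2)
          & phi (piGH 1%g) = 1]].

(* The spherical function and the highest weight vector of weight l; the
   default values are irrelevant for weights occurring in C[G/H]. *)
Definition sphericalFunction (l : weight) : GH -> R :=
  xget (fun=> 0) [set phi | is_spherical l phi].

Definition highestWeightVector (l : weight) : A :=
  xget 0 [set f | highest_weight_vector l f].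

Definition vec3 (T : nmodType) (a b c : T) : 'rV[T]_3 :=
  \row_(k < 3) [:: a; b; c]`_k.

Definition sLog (t : R) (x : GH) : 'rV[R]_3 :=
  let logt y := ln y / ln t in
  vec3 (logt (sphericalFunction (Omega 0 1) x))
       (logt (sphericalFunction (Omega 0 2) x))
       (logt (sphericalFunction (Omega 1 2) x)).

End SphericalFunctions.

Section ValuationCone.
Variable R : realType.
Local Notation A := (coordRing R).
Local Notation CGH := (ratFun R).

(* The value of v at 0 is irrelevant (it stands for +oo). Discreteness: the
   value group is cyclic; the trivial valuation is allowed. *)
Definition discrete_valuation (v : CGH -> rat) : Prop :=
  [/\ forall x y, x != 0 -> y != 0 -> v (x * y) = v x + v y,
      forall x y, x != 0 -> y != 0 -> x + y != 0 ->
        Num.min (v x) (v y) <= v (x + y),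
      forall c : R[i], c != 0 -> v (c%:A : A)%:F = 0
    & exists q : rat, forall x, x != 0 -> exists m : int, v x = m%:~R * q].

Definition G_invariant (v : CGH -> rat) : Prop :=
  forall g x, x != 0 -> v (frac_act g x) = v x.

Definition valuationCone : set 'rV[rat]_3 :=
  [set u | exists v, [/\ discrete_valuation v, G_invariant v
    & let f i j := (highestWeightVector R (Omega i j))%:F in
      u = vec3 (v (f 0 1)) (v (f 0 2)) (v (f 1 2))]].

Definition realValuationCone : set 'rV[R]_3 :=
  closure [set (map_mx ratr u : 'rV[R]_3) | u in valuationCone].

End ValuationCone.

Arguments borel R : clear implicits.
Arguments maxCompact R : clear implicits.
Arguments valuationCone R : clear implicits.
Arguments realValuationCone R : clear implicits.

Definition kuratowski_cvg (R : realType) (T : topologicalType)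
    (X : R -> set T) (X0 : set T) : Prop :=
  (forall y, ~ X0 y -> exists2 U, nbhs y U &
     exists2 eps : R, 0 < eps & forall t, 0 < t < eps -> X t `&` U = set0) /\
  (forall y, X0 y -> forall U, nbhs y U ->
     exists2 eps : R, 0 < eps & forall t, 0 < t < eps -> X t `&` U !=set0).

Definition cone3 (R : realType) (u v w : 'rV[R]_3) : set 'rV[R]_3 :=
  [set y | exists a b c : R, [/\ 0 <= a, 0 <= b, 0 <= c
    & y = a *: u + b *: v + c *: w]].

(* Main.v *)
(** The determinants of a row of [A_i] and a row of [A_j] span an irreducible
    submodule of [C[G/H]] of highest weight [Omega i j], on which invariance under
    the elements [diag(i, -i)] and the Weyl elements of the factors of [K] already
    determines the Hermitian product up to a scalar; hence the spherical function
    is half the sum of the squared moduli of these determinants. Since the rows of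
    [A_i] form a basis of determinant 1, the determinants of [(j, k)] are
    [2 x 2] minors in those of [(i, j)] and [(i, k)]. This one relation gives both
    [v_ij + v_ik <= v_jk] for every invariant valuation and
    [phi_jk <= 2 phi_ij phi_ik], that is, the same three inequalities for the
    limit of the spherical logarithms up to an error [ln 2 / ln t]. Conversely,
    every point of the cone is reached along the curves
    [k |-> diag(s_k^-1, s_k) kappa_k], where [kappa] is a point of the open Borel
    orbit: with [s_k = t ^ (a_k / 2)] for the spherical logarithm, and with
    [s_k = t ^ n_k] for the valuation given by the order at [t = 0] at a generic
    translate of the curve. *)

Require Import Defs.
From mathcomp Require Import all_boot all_order all_algebra.
From mathcomp Require Import fraction generic_quotient complex.
From mathcomp Require Import boolp classical_sets functions reals.
From mathcomp Require Import topology normedtype exp.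
From mathcomp Require Import sequences ring lra zify.

Set Implicit Arguments.
Unset Strict Implicit.
Unset Printing Implicit Defensive.

Import Order.TTheory GRing.Theory Num.Theory numFieldNormedType.Exports.

Local Open Scope ring_scope.
Local Open Scope classical_set_scope.

(** * Minors and the open Borel orbit *)

Section PolynomialFunctions.
Variable R : realType.
Local Notation C := R[i].
Local Notation G := (G R).
Local Notation A := (coordRing R).

Lemma polynomialG_sum (I : Type) (r : seq I) (F : I -> G -> C) :
  (forall i, polynomialG (F i)) -> polynomialG (fun g => \sum_(i <- r) F i g).
Proof.
move=> PF; elim: r => [|i r IH].
  by under eq_fun do rewrite big_nil; exact: poly_cst.
by under eq_fun do rewrite big_cons; exact: poly_add.
Qed.

Lemma polynomialG_sub (f f' : G -> C) :
  polynomialG f -> polynomialG f' -> polynomialG (fun g => f g - f' g).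
Proof.
move=> Pf Pf'; under eq_fun do rewrite -mulN1r.
by apply: poly_add => //; apply: poly_mul => //; exact: poly_cst.
Qed.

(* As for [coord_integral]: restrict both functions to a polynomial curve through
   a point where the first is nonzero and a point where the second is. *)
Lemma polynomialG_integral (f f' : G -> C) (g g' : G) :
  polynomialG f -> polynomialG f' -> f g != 0 -> f' g' != 0 ->
  exists h, f h * f' h != 0.
Proof.
move=> Pf Pf' fg f'g'; apply: contrapT => ff'0.
have [x hx] := choice (fun k => SL2elemP (g k)).
have [y hy] := choice hx; have [z hz] := choice hy; have [w hw] := choice hz.
have [x' hx'] := choice (fun k => SL2elemP (g' k)).
have [y' hy'] := choice hx'; have [z' hz'] := choice hy'.
have [w' hw'] := choice hz'.
have cv h (Ph : polynomialG h) := polynomialG_curve x y z w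
  (fun k => x' k - x k) (fun k => y' k - y k) (fun k => z' k - z k)
  (fun k => w' k - w k) Ph.
have [p hp] := cv _ Pf; have [p' hp'] := cv _ Pf'.
have pN0 : p != 0.
  apply: contraNneq fg => p0; have := hp 0; rewrite p0 horner0 => <-.
  apply/eqP; congr f; apply/ffunP => k; rewrite ffunE hw.
  by rewrite !mul0r !addr0.
have p'N0 : p' != 0.
  apply: contraNneq f'g' => p0; have := hp' 1; rewrite p0 horner0 => <-.
  apply/eqP; congr f'; apply/ffunP => k; rewrite ffunE hw'.
  by rewrite !mul1r !(addrC _ (_ - _)) !subrK.
have /eqP : p * p' = 0.
  apply: poly_zero => s; rewrite hornerM -hp -hp'; apply: contrapT => /eqP h.
  by apply: ff'0; eexists; exact: h.
by rewrite mulf_eq0 (negPf pN0) (negPf p'N0).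
Qed.

End PolynomialFunctions.

Section Minors.
Variable R : realType.
Local Notation C := R[i].
Local Notation G := (G R).
Local Notation A := (coordRing R).
Local Notation GH := (GH R).

Lemma mxE2 (S : pzSemiRingType) (M N : 'M[S]_2) i j :
  (M *m N) i j = M i 0 * N 0 j + M i 1 * N 1 j.
Proof.
rewrite mxE !big_ord_recl big_ord0 addr0.
by congr (_ + M _ _ * N _ _); apply: val_inj.
Qed.

Lemma sum2E (V : nmodType) (F : 'I_2 -> V) : \sum_i F i = F 0 + F 1.
Proof.
by rewrite !big_ord_recl big_ord0 addr0; congr (_ + F _); apply: val_inj.
Qed.

Lemma ord2P (P : 'I_2 -> Prop) : P 0 -> P 1 -> forall a, P a.
Proof.
move=> P0 P1 [[|[|//]] lt]; [move: P0|move: P1]; congr P; exact: val_inj.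
Qed.

Lemma ord3P (P : 'I_3 -> Prop) : P 0 -> P 1 -> P 2 -> forall a, P a.
Proof.
move=> P0 P1 P2 [[|[|[|//]]] lt]; [move: P0|move: P1|move: P2]; congr P;
  exact: val_inj.
Qed.

Lemma GmulE (g h : G) k : SL2val ((g * h)%g k) = SL2val (g k) *m SL2val (h k).
Proof. by rewrite ffunE. Qed.

Lemma GinvE (g : G) k : SL2val (g^-1%g k) = invmx (SL2val (g k)).
Proof. by rewrite ffunE. Qed.

Lemma SL2_det (M : SL2 R) : M 0 0 * M 1 1 - M 0 1 * M 1 0 = 1.
Proof. by rewrite -det_mx22 SL2P. Qed.

(* [minor i j 0 0] is the highest weight vector of weight [Omega i j]. *)
Definition minor (i j : 'I_3) (a b : 'I_2) (g : G) : C :=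
  SL2val (g i) a 0 * SL2val (g j) b 1 - SL2val (g i) a 1 * SL2val (g j) b 0.

Lemma polynomialG_minor i j a b : polynomialG (minor i j a b).
Proof. by apply: polynomialG_sub; apply: poly_mul; exact: poly_entry. Qed.

Lemma minor_diagG i j a b g h : minor i j a b (g * diagG h)%g = minor i j a b g.
Proof.
rewrite /minor !GmulE /diagG !ffunE !mxE2.
rewrite -[RHS]mulr1 -(SL2_det h); ring.
Qed.

Lemma minor_mul i j a b g h : minor i j a b (g * h)%g =
  \sum_p \sum_q SL2val (g i) a p * SL2val (g j) b q * minor i j p q h.
Proof. by rewrite /minor !GmulE !mxE2 !sum2E; ring. Qed.

Fact plucker_subproof i j a b :
  regular_fun (fun x : GH => minor i j a b (repr x)).
Proof.
apply/asboolP; suff -> : (fun g => minor i j a b (repr (piGH g))) = minor i j a b.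
  exact: polynomialG_minor.
apply/funext => g; have /piGH_eq[h {2}->] : piGH (repr (piGH g)) = piGH g.
  by rewrite /piGH reprK.
by rewrite minor_diagG.
Qed.

Definition plucker i j a b : A := MkCoordRing (plucker_subproof i j a b).

Lemma pluckerE i j a b g : plucker i j a b (piGH g) = minor i j a b g.
Proof.
rewrite /=; have /piGH_eq[h {2}->] : piGH (repr (piGH g)) = piGH g.
  by rewrite /piGH reprK.
by rewrite minor_diagG.
Qed.

Lemma coord_actE g (f : A) x : coord_act g f (piGH x) = f (piGH (g^-1 * x)%g).
Proof. by rewrite /= translE. Qed.

Lemma coord_act0 g : coord_act g 0 = 0 :> A.
Proof. by apply: coord_ext. Qed.

Lemma coordDE (f f' : A) x : (f + f') x = f x + f' x. Proof. by []. Qed.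
Lemma coordZE c (f : A) x : (c *: f) x = c * f x. Proof. by []. Qed.
Lemma coordME (f f' : A) x : (f * f') x = f x * f' x. Proof. by []. Qed.
Lemma coord0E x : (0 : A) x = 0. Proof. by []. Qed.
Lemma coordBE (f f' : A) x : (f - f') x = f x - f' x. Proof. by []. Qed.

Lemma coord_sumE (I : Type) (r : seq I) (F : I -> A) x :
  (\sum_(i <- r) F i) x = \sum_(i <- r) F i x.
Proof. by elim: r => [|i r IH]; rewrite ?big_nil // !big_cons coordDE IH. Qed.

Lemma coord_act_plucker i j a b g : coord_act g^-1%g (plucker i j a b) =
  \sum_p \sum_q (SL2val (g i) a p * SL2val (g j) b q) *: plucker i j p q.
Proof.
apply: coord_ext => x; rewrite coord_actE invgK pluckerE minor_mul coord_sumE.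
apply: eq_bigr => p _; rewrite coord_sumE; apply: eq_bigr => q _.
by rewrite coordZE pluckerE.
Qed.

Definition mx22 (a b c d : C) : 'M[C]_2 :=
  \matrix_(i, j) (if i == 0 then if j == 0 then a else b
                  else if j == 0 then c else d).

Lemma mx22E a b c d : [/\ mx22 a b c d 0 0 = a, mx22 a b c d 0 1 = b,
  mx22 a b c d 1 0 = c & mx22 a b c d 1 1 = d].
Proof. by split; rewrite mxE. Qed.

Lemma det_mx22E a b c d : \det (mx22 a b c d) = a * d - b * c.
Proof. by rewrite det_mx22; have [-> -> -> ->] := mx22E a b c d. Qed.

Fact basept_subproof (k : 'I_3) : \det (if k == 0 then mx22 1 0 0 1
  else if k == 1 then mx22 1 1 0 1 else mx22 0 1 (-1) 0) == 1.
Proof.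
by apply/eqP; case: (k == 0); [|case: (k == 1)]; rewrite det_mx22E; ring.
Qed.

(* A point of the open Borel orbit: the top rows of its three entries are
   pairwise independent. *)
Definition basept : G := [ffun k => MkSL2 (basept_subproof k)].

Lemma baseptE : [/\ SL2val (basept 0) = mx22 1 0 0 1,
  SL2val (basept 1) = mx22 1 1 0 1 & SL2val (basept 2) = mx22 0 1 (-1) 0].
Proof. by rewrite !ffunE. Qed.

Lemma minor_basept : [/\ minor 0 1 0 0 basept = 1, minor 0 2 0 0 basept = 1
  & minor 1 2 0 0 basept = 1].
Proof.
rewrite /minor; have [-> -> ->] := baseptE.
by split; rewrite !mxE /=; ring.
Qed.

Lemma plucker_neq0 i j a b : i != j -> plucker i j a b != 0.
Proof.
(* A point where the minor is 1 or -1: the [i]-th factor is the identity, and [M] is the Weyl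
   element or the identity so that its row [b] is independent of row [a] of the identity. *)
move=> ij; pose M : SL2 R := if a == b then MkSL2 (basept_subproof 2) else 1%g.
pose g : G := [ffun k => if k == i then 1%g else M].
apply/eqP => /(congr1 (fun f : A => f (piGH g))); rewrite pluckerE coord0E.
rewrite /minor !ffunE eqxx eq_sym (negPf ij) /M => /eqP; apply/negP.
move: a b {M g}; apply: ord2P; apply: ord2P; rewrite /= !mxE /=;
  rewrite ?(mulr0, mul0r, mulr1, mul1r, subr0, sub0r, oppr_eq0) ?oner_eq0 //.
Qed.

End Minors.

Section OpenOrbit.
Variable R : realType.
Local Notation C := R[i].
Local Notation G := (G R).
Local Notation A := (coordRing R).

(** Left multiplication by [b] only rescales the top rows, so it suffices to find [h] such that the
    top rows of [g] and of [basept * diagG h] are proportional; the quotient of the two is then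
    lower triangular. *)
Lemma open_borel_orbit (g : G) : minor 0 1 0 0 g != 0 -> minor 0 2 0 0 g != 0 ->
  minor 1 2 0 0 g != 0 ->
  exists2 b, borel R b & exists h, g = (b * basept R * diagG h)%g.
Proof.
set p := minor 0 1 0 0 g; set q := minor 0 2 0 0 g; set r := minor 1 2 0 0 g.
move=> p0 q0 r0.
(* [s k] is the character value that [b] takes on the [k]-th factor; it is
   forced by [s 0 * s 1 = p], [s 0 * s 2 = q] and [s 1 * s 2 = r]. *)
pose s0 := sqrtc (p * q / r).
have s0E : s0 ^+ 2 = p * q / r by rewrite sqr_sqrtc.
have s00 : s0 != 0 by rewrite sqrtc_eq0 !mulf_eq0 invr_eq0 !negb_or p0 q0.
pose s (k : 'I_3) : C := if k == 0 then s0 else if k == 1 then p / s0 else q / s0.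
(* The top rows of [basept] in the factors 0 and 2 are the standard basis vectors, which forces the
   rows of [h]. *)
pose M := mx22 (SL2val (g 0) 0 0 / s0) (SL2val (g 0) 0 1 / s0)
  (SL2val (g 2) 0 0 / (q / s0)) (SL2val (g 2) 0 1 / (q / s0)).
have dM : \det M == 1.
  apply/eqP; rewrite det_mx22E; have : q / q = 1 by rewrite divff.
  by rewrite -{1}/q {1}/q /minor => <-; field; rewrite s00 q0.
pose h := MkSL2 dM.
have rowE k c : SL2val (g k) 0 c =
    s k * (SL2val (basept R k) *m SL2val h) 0 c.
  have [e0 e1 e2] := baseptE R.
  move: k; apply: ord3P; rewrite /s /= ?e0 ?e1 ?e2 mxE2 /M.
  - by move: c; apply: ord2P; rewrite !mxE /=; field; rewrite s00.
  - have rE : r = p * q / s0 ^+ 2 by rewrite s0E; field; rewrite p0 q0 r0.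
    (* Cramer's linear relation between three vectors of a plane; at [basept] it reads (1,1) = (0,1)
       + (1,0). *)
    have P : q * SL2val (g 1) 0 c = p * SL2val (g 2) 0 c + r * SL2val (g 0) 0 c.
      by rewrite /q /p /r /minor; move: c; apply: ord2P; ring.
    apply: (mulfI q0); rewrite P rE.
    by move: c {P}; apply: ord2P; rewrite !mxE /=; field; rewrite s00 q0.
  - by move: c; apply: ord2P; rewrite !mxE /=; field; rewrite s00 q0.
exists (g * (basept R * diagG h)^-1)%g; last by exists h; rewrite -!mulgA mulVg mulg1.
move=> k; rewrite GmulE mxE2 GinvE !rowE GmulE.
set N := SL2val (basept R k) *m _.
have -> : SL2val (diagG h k) = h by rewrite ffunE.
rewrite -/N -2!mulrA -mulrDr -mxE2 mulmxV ?mxE ?mulr0 //.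
by rewrite unitmxE det_mulmx !SL2P mulr1 unitr1.
Qed.

(** As [b] is lower triangular of determinant 1, the top row of its inverse is ([b] 1 1, 0), so a
    single term of [coord_act_plucker] survives. *)
Lemma plucker_hwv i j : i != j -> highest_weight_vector (Omega i j) (plucker R i j 0 0).
Proof.
move=> ij; split; first exact: plucker_neq0.
move=> b Bb; rewrite -[b]invgK coord_act_plucker invgK.
have e k : SL2val (b^-1%g k) 0 0 = SL2val (b k) 1 1 /\ SL2val (b^-1%g k) 0 1 = 0.
  have V c : (SL2val (b k) *m SL2val (b^-1%g k)) 0 c = (0 == c)%:R.
    by rewrite GinvE mulmxV ?SL2unit // mxE.
  have d := SL2_det (b k); rewrite Bb mul0r subr0 in d.
  have b0 : SL2val (b k) 0 0 != 0.
    by apply/eqP => b0; move/eqP: d; rewrite b0 mul0r eq_sym oner_eq0.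
  have := V 0; have := V 1; rewrite !mxE2 Bb !mul0r !addr0 => v1 v0.
  split; apply: (mulfI b0); first by rewrite v0 d.
  by rewrite v1 mulr0.
rewrite !sum2E; have [-> ->] := e i; have [-> ->] := e j.
rewrite !(mulr0, mul0r, scale0r, addr0); congr (_ *: _).
rewrite /wchar (bigD1 i) //= (bigD1 j) 1?eq_sym //= big1 ?mulr1 => [|k /andP[ki kj]].
  by rewrite /Omega !eqxx (negPf ij) eq_sym (negPf ij) !expr1.
by rewrite /Omega (negPf ki) (negPf kj) expr0.
Qed.

Lemma borelV b : borel R b -> borel R b^-1%g.
Proof.
move=> Bb k; have d := SL2_det (b k); rewrite Bb mul0r subr0 in d.
have b0 : SL2val (b k) 0 0 != 0.
  by apply/eqP => b0; move/eqP: d; rewrite b0 mul0r eq_sym oner_eq0.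
have : (SL2val (b k) *m SL2val (b^-1%g k)) 0 1 = 0.
  by rewrite GinvE mulmxV ?SL2unit // mxE.
by rewrite mxE2 Bb mul0r addr0 => /eqP; rewrite mulf_eq0 (negPf b0) => /eqP.
Qed.

(** On the open Borel orbit, both functions are determined by their values at [basept] and the
    common character. The product of the three top-row minors vanishes off that orbit, so it
    annihilates the difference everywhere, and integrality of the coordinate ring removes it.
    Cross-multiplying avoids dividing by a value. *)
Lemma hwv_unique l (f f' : A) :
  highest_weight_vector l f -> highest_weight_vector l f' ->
  f' (piGH (basept R)) *: f = f (piGH (basept R)) *: f'.
Proof.
move=> [f0 Hf] [f'0 Hf']; set x := piGH _.
suff : (f' x *: f - f x *: f') *
  (plucker R 0 1 0 0 * plucker R 0 2 0 0 * plucker R 1 2 0 0) = 0.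
  have nz (i j : 'I_3) : i != j -> (plucker R i j 0 0 == 0) = false.
    by move=> ij; exact: negbTE (plucker_neq0 R 0 0 ij).
  by move/eqP; rewrite !mulf_eq0 !nz // !orbF subr_eq0 => /eqP.
apply: coord_ext => g; rewrite !coordME coord0E coordBE !coordZE !pluckerE.
have [->|p0] := eqVneq (minor 0 1 0 0 g) 0; first by rewrite !(mul0r, mulr0).
have [->|q0] := eqVneq (minor 0 2 0 0 g) 0; first by rewrite !(mul0r, mulr0).
have [->|r0] := eqVneq (minor 1 2 0 0 g) 0; first by rewrite !(mul0r, mulr0).
have [b Bb [h gE]] := open_borel_orbit p0 q0 r0.
have {gE} -> : piGH g = piGH (b * basept R)%g by apply/esym/piGH_eq; exists h.
have ev (e : A) : (forall b, borel R b -> coord_act b e = wchar l b *: e) ->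
    e (piGH (b * basept R)%g) = wchar l b^-1%g * e x.
  by move=> He; rewrite -coordZE -He ?coord_actE ?invgK //; exact: borelV.
by rewrite (ev f) ?(ev f') //; ring.
Qed.

Lemma basept_plucker (i j : 'I_3) : (i < j)%N -> plucker R i j 0 0 (piGH (basept R)) = 1.
Proof.
have [e1 e2 e3] := minor_basept R; rewrite pluckerE.
by move: i j; apply: ord3P; apply: ord3P.
Qed.

Lemma hwv_Omega (i j : 'I_3) (f : A) : (i < j)%N -> highest_weight_vector (Omega i j) f ->
  exists2 c, c != 0 & f = c *: plucker R i j 0 0.
Proof.
move=> ij Hf; have ij' : i != j by rewrite -val_eqE neq_ltn ij.
have := hwv_unique Hf (plucker_hwv ij'); rewrite basept_plucker // scale1r => fE.
exists (f (piGH (basept R))) => //; apply/eqP => c0.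
by case: Hf; rewrite fE c0 scale0r eqxx.
Qed.

End OpenOrbit.

(** * The submodule spanned by the minors *)

Section CompactGroup.
Variable R : realType.
Local Notation C := R[i].
Local Notation G := (G R).

Lemma normc2C (z : C) : ((Normc.normc z ^+ 2)%:C)%C = z * z^*%C.
Proof. by rewrite -sqr_normc -rmorphXn. Qed.

Lemma maxCompactV g : maxCompact R g -> maxCompact R g^-1%g.
Proof.
move=> Kg k; rewrite GinvE; set M := SL2val (g k).
have MM : M *m (map_mx conjc M)^T = 1%:M := Kg k.
have -> : invmx M = (map_mx conjc M)^T.
  by rewrite -[LHS]mulmx1 -MM mulmxA mulVmx ?mul1mx // SL2unit.
rewrite -(mulmx1C MM); congr (_ *m _).
by apply/matrixP => a b; rewrite !mxE conjcK.
Qed.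

Definition embed (i : 'I_3) (M : SL2 R) : G :=
  [ffun k => if k == i then M else 1%g].

Lemma embedE i M : SL2val (embed i M i) = M.
Proof. by rewrite ffunE eqxx. Qed.

Lemma embed_neq i k M : k != i -> SL2val (embed i M k) = 1%:M.
Proof. by move=> /negPf ki; rewrite ffunE ki. Qed.

Lemma maxCompact_embed i (M : SL2 R) :
  SL2val M *m (map_mx conjc (SL2val M))^T = 1%:M -> maxCompact R (embed i M).
Proof.
move=> HM k; rewrite ffunE; case: (k == i) => //.
by rewrite /= map_mx1 trmx1 mulmx1.
Qed.

Fact torus_subproof : \det (mx22 'i%C 0 0 (- 'i%C) : 'M[C]_2) == 1.
Proof. by rewrite det_mx22E mul0r subr0 mulrN -expr2 sqr_i opprK. Qed.

Definition torus := MkSL2 torus_subproof.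

Fact weyl_subproof : \det (mx22 0 1 (-1) 0 : 'M[C]_2) == 1.
Proof. by apply/eqP; rewrite det_mx22E; ring. Qed.

Definition weyl := MkSL2 weyl_subproof.

Lemma torus_unitary :
  SL2val torus *m (map_mx conjc (SL2val torus))^T = 1%:M.
Proof.
apply/matrixP; apply: ord2P; apply: ord2P; rewrite mxE2 !mxE /=;
  by apply/eqP; rewrite eq_complex /=; apply/andP; split; apply/eqP; ring.
Qed.

Lemma weyl_unitary :
  SL2val weyl *m (map_mx conjc (SL2val weyl))^T = 1%:M.
Proof.
apply/matrixP; apply: ord2P; apply: ord2P; rewrite mxE2 !mxE /=;
  by apply/eqP; rewrite eq_complex /=; apply/andP; split; apply/eqP; ring.
Qed.

End CompactGroup.

Section SphericalModule.
Variables (R : realType) (i j : 'I_3).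
Hypothesis ij : i != j.
Local Notation C := R[i].
Local Notation G := (G R).
Local Notation A := (coordRing R).
Local Notation D := (plucker R i j).

Definition comb (c : 'M[C]_2) : A := \sum_a \sum_b c a b *: D a b.

Lemma combE c x : comb c x = \sum_a \sum_b c a b * D a b x.
Proof.
by rewrite coord_sumE; apply: eq_bigr => a _; rewrite coord_sumE.
Qed.

Lemma comb_linear k c c' : comb (k *: c + c') = k *: comb c + comb c'.
Proof.
apply: coord_ext => x; rewrite coordDE coordZE !combE !sum2E !mxE; ring.
Qed.

Lemma comb0 : comb 0 = 0.
Proof. by rewrite /comb !sum2E !mxE !scale0r !addr0. Qed.

Lemma combZ k c : comb (k *: c) = k *: comb c.
Proof. by rewrite -[k *: c]addr0 comb_linear comb0 addr0. Qed.

Lemma comb_delta a b : comb (delta_mx a b) = D a b.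
Proof.
by move: a b; apply: ord2P; apply: ord2P;
  rewrite /comb !sum2E !mxE /= !scale0r !scale1r ?addr0 ?add0r.
Qed.

Lemma act_comb g c : coord_act g^-1%g (comb c) =
  comb ((SL2val (g i))^T *m c *m SL2val (g j)).
Proof.
apply: coord_ext => x; rewrite coord_actE invgK !combE.
under eq_bigr do under eq_bigr do rewrite pluckerE minor_mul.
under [RHS]eq_bigr do under eq_bigr do rewrite pluckerE !mxE2.
by rewrite !sum2E !mxE; ring.
Qed.

Definition pluckerModule : set A := [set f | exists c, f = comb c].

Lemma submodule_pluckerModule : submodule pluckerModule.
Proof.
split; first by exists 0; rewrite comb0.
  by move=> k _ _ [c ->] [c' ->]; exists (k *: c + c'); rewrite comb_linear.
by move=> g _ [c ->]; rewrite -[g]invgK act_comb; eexists.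
Qed.

Lemma plucker_in a b : pluckerModule (D a b).
Proof. by exists (delta_mx a b); rewrite comb_delta. Qed.

Lemma submoduleZ (U : set A) k f : submodule U -> U f -> U (k *: f).
Proof. by case=> U0 UD _ Uf; rewrite -[_ *: _]addr0; exact: UD. Qed.

(* [torus] acts on the rows of the coefficient matrix by the distinct scalars
   ['i] and [-'i], hence projects onto each row; likewise for columns. *)
Lemma submodule_row (U : set A) c a : submodule U -> U (comb c) ->
  U (comb (\matrix_(p, q) (if p == a then c p q else 0))).
Proof.
move=> sU Uc; have [U0 UD Uact] := sU.
(* The inverse of the eigenvalue of [torus] on row [a]; on the other row the product with [s] is -1,
   so averaging with the identity is the projection. *)
pose s : C := if a == 0 then - 'i%C else 'i%C.
pose g := embed i (torus R).
suff -> : comb (\matrix_(p, q) (if p == a then c p q else 0)) =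
    2^-1 *: (s *: coord_act g^-1%g (comb c) + comb c).
  by apply: submoduleZ => //; apply: UD => //; exact: Uact.
rewrite act_comb embedE embed_neq 1?eq_sym // -comb_linear -combZ mulmx1.
have i2 : 'i%C * 'i%C = -1 :> C by rewrite -expr2 sqr_i.
have half x : 2^-1 * (x + x) = x :> C by rewrite -mulr2n -[x *+ _]mulr_natl
  mulKf ?pnatr_eq0.
congr comb; apply/matrixP => p q; rewrite !(mxE, mxE2) /s.
move: a p {s}; apply: ord2P; apply: ord2P;
  rewrite /= ?(mul0r, mulr0, addr0, add0r) ?[_ * 'i%C]mulrC ?[_ * - 'i%C]mulrC;
  by rewrite ?(mulNr, mulrN) ?opprK mulrA i2 mulN1r ?opprK ?addNr ?mulr0 ?half.
Qed.

Lemma submodule_col (U : set A) c b : submodule U -> U (comb c) ->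
  U (comb (\matrix_(p, q) (if q == b then c p q else 0))).
Proof.
move=> sU Uc; have [U0 UD Uact] := sU.
pose s : C := if b == 0 then - 'i%C else 'i%C.
pose g := embed j (torus R).
suff -> : comb (\matrix_(p, q) (if q == b then c p q else 0)) =
    2^-1 *: (s *: coord_act g^-1%g (comb c) + comb c).
  by apply: submoduleZ => //; apply: UD => //; exact: Uact.
rewrite act_comb embedE embed_neq // -comb_linear -combZ trmx1 mul1mx.
have i2 : 'i%C * 'i%C = -1 :> C by rewrite -expr2 sqr_i.
have half x : 2^-1 * (x + x) = x :> C by rewrite -mulr2n -[x *+ _]mulr_natl
  mulKf ?pnatr_eq0.
congr comb; apply/matrixP => p q; rewrite !(mxE, mxE2) /s.
move: b q {s}; apply: ord2P; apply: ord2P;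
  rewrite /= ?(mul0r, mulr0, addr0, add0r) ?[_ * 'i%C]mulrC ?[_ * - 'i%C]mulrC;
  by rewrite ?(mulNr, mulrN) ?opprK mulrA i2 mulN1r ?opprK ?addNr ?mulr0 ?half.
Qed.

Lemma submodule_term (U : set A) c a b : submodule U -> U (comb c) ->
  U (c a b *: D a b).
Proof.
move=> sU /(submodule_row a sU) /(submodule_col b sU).
congr U; rewrite -comb_delta -combZ; congr comb; apply/matrixP => p q.
rewrite !mxE [(p == a) && _]andbC.
case: (q =P b) => [->|_]; last by rewrite /= mulr0.
by case: (p =P a) => [->|_]; rewrite /= ?mulr1 ?mulr0.
Qed.

(** Linear independence of the four minors: [submodule_term] for the zero submodule isolates each
    term of a vanishing combination. *)
Lemma comb_inj : injective comb.
Proof.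
move=> c c' e; have sZ : submodule [set (0 : A)].
  split=> [//|k f f' -> ->|g f ->]; rewrite /= ?coord_act0 //.
  by rewrite scaler0 addr0.
have /(submodule_term _ _ sZ) Z : [set (0 : A)] (comb (- 1 *: c' + c)).
  by rewrite /= comb_linear e scaleN1r addNr.
apply/matrixP => a b; have /eqP := Z a b.
rewrite scaler_eq0 (negPf (plucker_neq0 _ _ _ ij)) orbF !mxE mulN1r addrC subr_eq0.
by move/eqP.
Qed.

Lemma act_weyl b : coord_act (embed i (weyl R))^-1%g (D 0 b) = D 1 b /\
  coord_act (embed i (weyl R))^-1%g (D 1 b) = - D 0 b.
Proof.
rewrite !coord_act_plucker embedE embed_neq 1?eq_sym //.
by move: b; apply: ord2P; rewrite !sum2E !mxE /= !(mul0r, mulr0, mulr1, scale0r,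
  addr0, add0r, scale1r, scaleN1r).
Qed.

Lemma act_weyl' a : coord_act (embed j (weyl R))^-1%g (D a 0) = D a 1 /\
  coord_act (embed j (weyl R))^-1%g (D a 1) = - D a 0.
Proof.
rewrite !coord_act_plucker embedE embed_neq //.
by move: a; apply: ord2P; rewrite !sum2E !mxE /= !(mul0r, mulr0, mul1r, scale0r,
  addr0, add0r, scale1r, scaleN1r).
Qed.

(** The Weyl elements of the factors [i] and [j] permute the four minors transitively up to sign, so
    one of them generates the module. *)
Lemma submodule_plucker (U : set A) a b : submodule U -> U (D a b) ->
  pluckerModule `<=` U.
Proof.
move=> sU Uab; have [U0 UD Uact] := sU.
have Ua0 b' : forall a a', U (D a b') -> U (D a' b').
  have [w0 w1] := act_weyl b'.
  apply: ord2P => a'; move: a'; apply: ord2P => // Ub.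
  - by rewrite -w0; exact: Uact.
  - by rewrite -[D 0 b']opprK -scaleN1r -w1; apply: submoduleZ => //; exact: Uact.
have U0b a' : forall b b', U (D a' b) -> U (D a' b').
  have [w0 w1] := act_weyl' a'.
  apply: ord2P => b'; move: b'; apply: ord2P => // Ub.
  - by rewrite -w0; exact: Uact.
  - by rewrite -[D a' 0]opprK -scaleN1r -w1; apply: submoduleZ => //; exact: Uact.
have Uall a' b' : U (D a' b') by apply: (U0b _ b); exact: (Ua0 _ a).
move=> _ [c ->]; rewrite /comb !sum2E -!addrA.
by do 3 (apply: (UD) => //); rewrite -[_ *: _]addr0; exact: UD.
Qed.

Lemma irreducible_pluckerModule : irreducible pluckerModule.
Proof.
split; first exact: submodule_pluckerModule.
  move=> E; have /negP := plucker_neq0 R 0 0 ij; apply; apply/eqP.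
  by have := plucker_in 0 0; rewrite E.
move=> U sU UP; have [U0 _ _] := sU.
have [[f Uf f0]|nU] := pselect (exists2 f, U f & f != 0); [right|left].
  apply/seteqP; split=> //; have [c fE] := UP _ Uf; rewrite fE in Uf f0.
  have [/existsP[a /existsP[b cab]]|/existsPn c0] :=
      boolP [exists a, exists b, c a b != 0].
    apply: (submodule_plucker sU (a := a) (b := b)).
    rewrite -[D a b]scale1r -(mulVf cab) -scalerA; apply: submoduleZ => //.
    exact: submodule_term.
  case/negP: f0; apply/eqP; rewrite -[RHS]comb0; congr comb; apply/matrixP => a b.
  by have /existsPn/(_ b)/negPn/eqP -> := c0 a; rewrite mxE.
apply/seteqP; split=> [f Uf /=|f ->//].
by apply: contrapT => f0; apply: nU; exists f => //; apply/eqP.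
Qed.

End SphericalModule.

(** * Spherical functions *)

(** With [s] the complex conjugation this is the invariance of the Frobenius product under unitary
    changes of coordinates, which yields [K_invariant_stdform]. [Q] cancels directly and [P] after a
    cyclic permutation under the trace. *)
Lemma mxtrace_unitary (F : comNzRingType) (s : {rmorphism F -> F}) n
    (P Q c e : 'M[F]_n) :
  P *m (map_mx s P)^T = 1%:M -> Q *m (map_mx s Q)^T = 1%:M ->
  \tr ((P^T *m c *m Q) *m (map_mx s (P^T *m e *m Q))^T) =
  \tr (c *m (map_mx s e)^T).
Proof.
move=> UP UQ; have UP' : map_mx s P *m P^T = 1%:M.
  by apply: trmx_inj; rewrite trmx1 trmx_mul trmxK.
rewrite !map_mxM !trmx_mul !mulmxA -(mulmxA _ Q) UQ mulmx1.
by rewrite mxtrace_mulC !mulmxA -map_trmx trmxK UP' mul1mx.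
Qed.

Section SphericalFunction.
Variables (R : realType) (i j : 'I_3).
Hypothesis ij : (i < j)%N.
Local Notation C := R[i].
Local Notation G := (G R).
Local Notation A := (coordRing R).
Local Notation GH := (GH R).
Local Notation D := (plucker R i j).
Local Notation M := (@pluckerModule R i j).

Let ij' : i != j. Proof. by rewrite -val_eqE neq_ltn ij. Qed.

(** The highest weight vector in [V] is a multiple of [D 0 0], which generates [M]; irreducibility
    of [V] then forces equality. *)
Lemma simple_submoduleE (V : set A) : simple_submodule (Omega i j) V -> V = M.
Proof.
move=> [[sV _ Vmin] [f Vf /(hwv_Omega ij)[c c0 fE]]].
have MV : M `<=` V.
  apply: (submodule_plucker ij' sV (a := 0) (b := 0)).
  by rewrite -[D 0 0]scale1r -(mulVf c0) -scalerA -fE; exact: submoduleZ.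
have [M0|//] := Vmin _ (submodule_pluckerModule R i j) MV.
by case: (irreducible_pluckerModule R ij') => _ /(_ M0).
Qed.

Lemma simple_pluckerModule : simple_submodule (Omega i j) M.
Proof.
split; first exact: irreducible_pluckerModule.
by exists (D 0 0); [exact: plucker_in | exact: plucker_hwv].
Qed.

(** Expand one factor of each squared modulus by the first relation and exchange the sums: the
    second relation, conjugated, turns the inner sums into squared moduli of the [d a b]. This
    handles a basis of any length [n] without a dimension count. *)
Lemma tight_frame n (d : 'I_2 -> 'I_2 -> C) (f : 'I_n -> C) (U : 'I_n -> 'M[C]_2)
    (N : R) : 0 < N -> (forall k, f k = \sum_a \sum_b U k a b * d a b) ->
    (forall a b, d a b = \sum_k (N%:C)%C * (U k a b)^*%C * f k) ->
  \sum_k Normc.normc (f k) ^+ 2 = N^-1 * \sum_a \sum_b Normc.normc (d a b) ^+ 2.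
Proof.
move=> N0 fE dE.
have NC : (N%:C)%C != 0 :> C by rewrite eq_complex /= gt_eqF.
apply: complexI; rewrite rmorphM fmorphV; apply: (mulfI NC); rewrite mulVKf //.
rewrite !rmorph_sum mulr_sumr /=.
under eq_bigr do rewrite normc2C {1}fE !mulr_suml mulr_sumr.
rewrite exchange_big /=; apply: eq_bigr => a _; rewrite rmorph_sum /=.
under eq_bigr do rewrite mulr_suml mulr_sumr.
rewrite exchange_big /=; apply: eq_bigr => b _.
rewrite normc2C {3}dE rmorph_sum mulr_sumr; apply: eq_bigr => k _.
by rewrite !rmorphM /= conjcK oppr0 -[(N +i* 0)%C]/((N%:C)%C); ring.
Qed.

Section Hermitian.
Variable h : A -> A -> C.
Hypotheses (Hh : hermitian_product M h) (Kh : K_invariant M h).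

Lemma herm0l e : M e -> h 0 e = 0.
Proof.
move=> Me; have [M0 _ _] := submodule_pluckerModule R i j.
have [hD _ _] := Hh; have := hD 1 _ _ _ M0 M0 Me.
by rewrite scale1r addr0 mul1r => /eqP; rewrite eq_sym -subr_eq0 addrK => /eqP.
Qed.

Lemma hermZl c f e : M f -> M e -> h (c *: f) e = c * h f e.
Proof.
move=> Mf Me; have [M0 _ _] := submodule_pluckerModule R i j.
have [hD _ _] := Hh; have := hD c _ _ _ Mf M0 Me.
by rewrite addr0 herm0l // addr0.
Qed.

Lemma hermZr c f e : M f -> M e -> h f (c *: e) = c^*%C * h f e.
Proof.
move=> Mf Me; have [_ hC _] := Hh.
have Mce : M (c *: e) by apply: submoduleZ => //; exact: submodule_pluckerModule.
by rewrite hC // hermZl // rmorphM /= -hC.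
Qed.

Lemma herm_suml (I : Type) (r : seq I) (c : I -> C) (F : I -> A) e :
  (forall k, M (F k)) -> M e ->
  h (\sum_(k <- r) c k *: F k) e = \sum_(k <- r) c k * h (F k) e.
Proof.
move=> MF Me; have [M0 MD _] := submodule_pluckerModule R i j.
have [hD _ _] := Hh.
elim: r => [|k r IH]; first by rewrite !big_nil herm0l.
rewrite !big_cons hD // ?IH //; elim: r {IH} => [|l r IH]; first by rewrite big_nil.
by rewrite big_cons; exact: MD.
Qed.

Lemma herm_comb c a b : h (comb i j c) (D a b) =
  \sum_p \sum_q c p q * h (D p q) (D a b).
Proof.
rewrite /comb pair_bigA /= (herm_suml _ (fun p => c p.1 p.2) (F := fun p => D p.1 p.2)).
- by rewrite [RHS]pair_bigA.
- by move=> k; exact: plucker_in.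
- exact: plucker_in.
Qed.

(** An eigenvalue of [torus] times the conjugate of the other one is -1, so invariance makes the
    product of two distinct minors equal to its own opposite. The Weyl elements equate the four
    norms. *)
Lemma herm_plucker : exists2 N : R, 0 < N & forall a b a' b',
  h (D a b) (D a' b') = ((N *+ ((a == a') && (b == b')))%:C)%C.
Proof.
have MD a b : M (D a b) by exact: plucker_in.
have Ki g f e : maxCompact R g -> M f -> M e ->
    h (coord_act g^-1%g f) (coord_act g^-1%g e) = h f e.
  by move=> /maxCompactV; exact: Kh.
have Ti k := maxCompact_embed k (torus_unitary R).
have Wi k := maxCompact_embed k (weyl_unitary R).
have N0 z : z = - z -> z = 0 :> C by move=> /eqP; rewrite eq_sym eqNr => /eqP.
have Ta a b : coord_act (embed i (torus R))^-1%g (D a b) =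
    SL2val (torus R) a a *: D a b.
  rewrite coord_act_plucker embedE embed_neq 1?eq_sym //.
  by move: a b; apply: ord2P; apply: ord2P; rewrite !sum2E !mxE /=
    !(mul0r, mulr0, mulr1, scale0r, addr0, add0r).
have Tb a b : coord_act (embed j (torus R))^-1%g (D a b) =
    SL2val (torus R) b b *: D a b.
  rewrite coord_act_plucker embedE embed_neq //.
  by move: a b; apply: ord2P; apply: ord2P; rewrite !sum2E !mxE /=
    !(mul0r, mulr0, mul1r, scale0r, addr0, add0r).
have TT a a' : a != a' ->
    SL2val (torus R) a a * (SL2val (torus R) a' a')^*%C = -1.
  move: a a'; apply: ord2P; apply: ord2P => // _; rewrite !mxE;
    by apply/eqP; rewrite eq_complex /=; apply/andP; split; apply/eqP; ring.
have oa a a' b b' : a != a' -> h (D a b) (D a' b') = 0.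
  move=> aa'; apply: N0; rewrite -[LHS](Ki _ _ _ (Ti i)) // !Ta.
  rewrite hermZl // ?hermZr // ?mulrA ?(TT _ _ aa') ?mulN1r //.
  by apply: submoduleZ => //; exact: submodule_pluckerModule.
have ob a a' b b' : b != b' -> h (D a b) (D a' b') = 0.
  move=> bb'; apply: N0; rewrite -[LHS](Ki _ _ _ (Ti j)) // !Tb.
  rewrite hermZl // ?hermZr // ?mulrA ?(TT _ _ bb') ?mulN1r //.
  by apply: submoduleZ => //; exact: submodule_pluckerModule.
have wa b : h (D 1 b) (D 1 b) = h (D 0 b) (D 0 b).
  by rewrite -[RHS](Ki _ _ _ (Wi i)) // (act_weyl R ij' b).1.
have wb a : h (D a 1) (D a 1) = h (D a 0) (D a 0).
  by rewrite -[RHS](Ki _ _ _ (Wi j)) // (act_weyl' R ij' a).1.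
have [_ _ hp] := Hh; have := hp _ (MD 0 0) (plucker_neq0 R 0 0 ij').
(* Positivity in [R[i]] includes the vanishing of the imaginary part, so the common norm is a real
   number. *)
rewrite ltcE /= => /andP[/eqP im0 N_gt0].
exists (complex.Re (h (D 0 0) (D 0 0))) => // a b a' b'.
have [<-|aa'] := eqVneq a a'; last by rewrite oa.
have [<-|bb'] := eqVneq b b'; last by rewrite ob.
have -> : h (D a b) (D a b) = h (D 0 0) (D 0 0).
  by move: a b; apply: ord2P; apply: ord2P; rewrite ?wa ?wb.
by apply/eqP; rewrite eq_complex /= im0 !eqxx.
Qed.

(** If [U] expresses the basis in the minors, then the coefficient of a minor along [e k] is its
    product with [e k], which by [herm_plucker] is [N] times the conjugate entry of [U]. This is the
    situation of [tight_frame]. *)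
Lemma sum_orthonormal_basis n (e : 'I_n -> A) : orthonormal_basis M h e ->
  exists2 N : R, 0 < N & forall x, \sum_k Normc.normc (e k x) ^+ 2 =
    N^-1 * \sum_a \sum_b Normc.normc (D a b x) ^+ 2.
Proof.
move=> [Me oe se]; have [N N0 hN] := herm_plucker; exists N => // x.
have [_ hC _] := Hh.
have MD a b : M (D a b) by exact: plucker_in.
have [U eU] := choice Me.
have hU k a b : h (e k) (D a b) = U k a b * (N%:C)%C.
  rewrite eU herm_comb (bigD1 a) //= (bigD1 b) //= hN !eqxx mulr1n.
  rewrite big1 ?addr0 => [|q /negPf qb]; last by rewrite hN qb andbF mulr0.
  rewrite big1 ?addr0 // => p /negPf pa; rewrite big1 // => q _.
  by rewrite hN pa mulr0.
have Dx a b : D a b x = \sum_k (N%:C)%C * (U k a b)^*%C * e k x.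
  have [w DE] := se _ (MD a b); rewrite {1}DE coord_sumE; apply: eq_bigr => k _.
  rewrite coordZE; congr (_ * _).
  have : h (D a b) (e k) = w k.
    rewrite DE herm_suml // (bigD1 k) //= oe eqxx mulr1 big1 ?addr0 // => l /negPf lk.
    by rewrite oe lk mulr0.
  by rewrite hC // hU rmorphM /= oppr0 mulrC => <-.
apply: (tight_frame N0 _ Dx) => k; by rewrite {1}eU combE.
Qed.

End Hermitian.

(** At the identity two of the four determinants have modulus 1 and the other two vanish, whence the
    factor 1/2. *)
Definition chord (x : GH) : R := 2^-1 * \sum_a \sum_b Normc.normc (D a b x) ^+ 2.

Lemma chord1 : chord (piGH 1%g) = 1.
Proof.
rewrite /chord !sum2E !pluckerE /minor !ffunE !mxE /=.
rewrite !(mulr0, mul0r, mulr1, mul1r, subr0, sub0r).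
by rewrite !sqr_sqrtr ?addr_ge0 ?sqr_ge0 //; field.
Qed.

Lemma is_sphericalE phi : is_spherical (Omega i j) phi -> phi = chord.
Proof.
move=> [V [h [n [e [c [/simple_submoduleE -> Hh Kh oe [c0 phiE phi1]]]]]]].
have [N N0 eN] := sum_orthonormal_basis Hh Kh oe.
have phiC : phi = fun x => c * N^-1 * 2 * chord x.
  by apply/funext => x; rewrite phiE eN /chord; field; rewrite gt_eqF.
by rewrite phiC chord1 mulr1 in phi1; rewrite phiC phi1; apply/funext => x; rewrite mul1r.
Qed.

Definition coef (f : A) : 'M[C]_2 := xget 0 [set c | f = comb i j c].

Lemma coefE c : coef (comb i j c) = c.
Proof.
by apply: xget_unique => // c' /= e; apply: (comb_inj ij').
Qed.

Lemma coef_delta a b : coef (D a b) = delta_mx a b.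
Proof. by rewrite -comb_delta coefE. Qed.

(** The Frobenius product of coefficient matrices. It provides an invariant Hermitian product on the
    module, so that a spherical function exists and the [xget] in [sphericalFunction] does not
    return its default. *)
Definition stdform (f e : A) : C := \sum_a \sum_b coef f a b * (coef e a b)^*%C.

Lemma stdformE f e : stdform f e = \tr (coef f *m (map_mx conjc (coef e))^T).
Proof.
by rewrite /stdform /mxtrace; apply: eq_bigr => a _; rewrite mxE;
  apply: eq_bigr => b _; rewrite !mxE.
Qed.

Lemma hermitian_stdform : hermitian_product M stdform.
Proof.
split.
- move=> c _ _ e [u ->] [v ->] _; rewrite /stdform -comb_linear !coefE !sum2E !mxE.
  by ring.
- move=> f e _ _; rewrite /stdform rmorph_sum; apply: eq_bigr => a _.
  by rewrite rmorph_sum; apply: eq_bigr => b _; rewrite rmorphM /= conjcK mulrC.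
- move=> _ [u ->] u0; rewrite /stdform coefE lt_neqAle; apply/andP; split; last first.
    by apply: sumr_ge0 => a _; apply: sumr_ge0 => b _; exact: mulcJ_ge0.
  rewrite eq_sym; apply: contraNneq u0 => /eqP.
  rewrite psumr_eq0 => [/allP u0|a _]; last by apply: sumr_ge0 => b _; exact: mulcJ_ge0.
  rewrite (_ : u = 0) ?comb0 //; apply/matrixP => a b; rewrite mxE.
  have := u0 a; rewrite mem_index_enum => /(_ isT) /=.
  rewrite psumr_eq0 => [/allP/(_ b)|q _]; last exact: mulcJ_ge0.
  by rewrite mem_index_enum => /(_ isT) /=; rewrite mulf_eq0 conjc_eq0 orbb => /eqP.
Qed.

Lemma K_invariant_stdform : K_invariant M stdform.
Proof.
move=> k _ _ /maxCompactV Kk [u ->] [v ->].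
rewrite -[k]invgK !act_comb !stdformE !coefE; set k' := k^-1%g.
have U l : SL2val (k' l) *m (map_mx conjc (SL2val (k' l)))^T = 1%:M := Kk l.
exact: (mxtrace_unitary (s := conjc) _ _ (U i) (U j)).
Qed.

Lemma orthonormal_basis_plucker : exists n (e : 'I_n -> A),
  orthonormal_basis M stdform e.
Proof.
pose T := [set: 'I_2 * 'I_2]%SET.
exists #|T|, (fun k => D (enum_val k).1 (enum_val k).2); split.
- by move=> k; exact: plucker_in.
- move=> k l; rewrite /stdform !coef_delta -(inj_eq enum_val_inj).
  rewrite (bigD1 (enum_val k).1) //= (bigD1 (enum_val k).2) //=.
  rewrite !big1 ?addr0 => [|p pk|q qk].
  + by rewrite !mxE !eqxx mul1r conjc_nat.
  + by rewrite big1 // => q _; rewrite mxE (negPf pk) mul0r.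
  + by rewrite mxE (negPf qk) andbF mul0r.
- move=> _ [c ->]; exists (fun k => c (enum_val k).1 (enum_val k).2).
  rewrite -(big_enum_val (fun p => c p.1 p.2 *: D p.1 p.2)) /comb pair_bigA.
  by apply: eq_bigl => p; rewrite inE.
Qed.

Lemma is_spherical_chord : is_spherical (Omega i j) chord.
Proof.
have [n [e oe]] := orthonormal_basis_plucker.
have [N N0 eN] :=
  sum_orthonormal_basis hermitian_stdform K_invariant_stdform oe.
exists M, stdform, n, e, (2^-1 * N); split => //.
- exact: simple_pluckerModule.
- exact: hermitian_stdform.
- exact: K_invariant_stdform.
split; first by rewrite mulr_gt0 ?invr_gt0.
  by apply/funext => x; rewrite eN /chord mulrA mulfK ?gt_eqF.
exact: chord1.
Qed.

Lemma sphericalFunctionE : sphericalFunction (Omega i j) = chord.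
Proof. by apply: xget_unique; [exact: is_spherical_chord|exact: is_sphericalE]. Qed.

End SphericalFunction.

(** * Orders of vanishing along a curve *)

Section Curve.
Variable R : realType.
Local Notation C := R[i].
Local Notation G := (G R).

(** The value at [s = 0] is a placeholder that makes [scal] total; the curves are only evaluated at
    nonzero parameters. *)
Fact scal_subproof (s : C) :
  \det (if s == 0 then 1%:M else mx22 s^-1 0 0 s) == 1.
Proof.
have [_|s0] := eqVneq s 0; first by rewrite det1.
by rewrite det_mx22E mulr0 subr0 mulVf.
Qed.

Definition scal (s : C) : SL2 R := MkSL2 (scal_subproof s).

Definition curve (s : 'I_3 -> C) : G := [ffun k => (scal (s k) * basept R k)%g].

(* The diagonal entry of [scal s] in row [a]. *)
Definition sgnpow (a : 'I_2) (s : C) : C := if a == 0 then s^-1 else s.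

Lemma curveE s k a c : s k != 0 ->
  SL2val (curve s k) a c = sgnpow a (s k) * SL2val (basept R k) a c.
Proof.
move=> s0; rewrite ffunE; set M := basept R k.
rewrite (_ : SL2val (_ * _)%g = SL2val (scal (s k)) *m SL2val M) // mxE2 /=.
rewrite (negPf s0); move: a; apply: ord2P; rewrite !mxE /sgnpow /=;
  by rewrite mul0r ?addr0 ?add0r.
Qed.

Lemma minor_curve s i j a b : (forall k, s k != 0) -> minor i j a b (curve s) =
  sgnpow a (s i) * sgnpow b (s j) * minor i j a b (basept R).
Proof. by move=> s0; rewrite /minor !curveE //; ring. Qed.

End Curve.

Section CurveOrder.
Variables (R : realType) (n : 'I_3 -> nat).
Local Notation C := R[i].
Local Notation G := (G R).
Local Notation A := (coordRing R).
Local Notation crv t := (curve (fun k => t ^+ n k)).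

(* [F (g * crv t)], a Laurent polynomial in [t] whose coefficients are regular
   functions of [g], is divisible by [t ^ m]. *)
Definition expansion (F : G -> C) (m : int) (Q : G -> {poly C}) :=
  (forall l, polynomialG (fun g => (Q g)`_l)) /\
  forall g t, t != 0 -> F (g * crv t)%g = t ^ m * (Q g).[t].

Definition order_ge F m := exists Q, expansion F m Q.

(** The lowest coefficient is a regular function of [g], so being nonzero at one [g] means being
    nonzero at a generic one: [m] is the order at [t = 0] along a generic translate of the curve. *)
Definition order F m := exists2 Q, expansion F m Q & exists g, (Q g)`_0 != 0.

Lemma order_order_ge F m : order F m -> order_ge F m.
Proof. by case=> Q; exists Q. Qed.

Lemma order_ge_weaken F m m' : m' <= m -> order_ge F m -> order_ge F m'.
Proof.
move=> mm' [Q [PQ FQ]].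
have [d dE] : exists d : nat, m = m' + d%:Z.
  by exists `|m - m'|%N; rewrite gez0_abs ?subr_ge0 // [RHS]addrC subrK.
exists (fun g => Q g * 'X^d); split=> [l|g t t0].
  under eq_fun do rewrite coefMXn.
  by case: (l < d)%N; [exact: poly_cst | exact: PQ].
by rewrite FQ // dE expfzDr // hornerM hornerXn mulrAC mulrA.
Qed.

Lemma order_geD F F' m : order_ge F m -> order_ge F' m ->
  order_ge (fun g => F g + F' g) m.
Proof.
move=> [Q [PQ FQ]] [Q' [PQ' FQ']]; exists (fun g => Q g + Q' g).
split=> [l|g t t0]; first by under eq_fun do rewrite coefD; exact: poly_add.
by rewrite FQ // FQ' // hornerD mulrDr.
Qed.

Lemma expansionM F F' m m' Q Q' : expansion F m Q -> expansion F' m' Q' ->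
  expansion (fun g => F g * F' g) (m + m') (fun g => Q g * Q' g).
Proof.
move=> [PQ FQ] [PQ' FQ']; split=> [l|g t t0].
  under eq_fun do rewrite coefM.
  by apply: polynomialG_sum => k; exact: poly_mul.
by rewrite FQ // FQ' // hornerM expfzDr // mulrACA.
Qed.

Lemma order_ge_polynomialG F : polynomialG F -> exists m, order_ge F m.
Proof.
elim=> [c|k a c|f f' _ [m mf] _ [m' mf']|f f' _ [m [Q fQ]] _ [m' [Q' fQ']]].
- exists 0, (fun=> c%:P); split=> [l|g t t0]; first exact: poly_cst.
  by rewrite expr0z mul1r hornerC.
(* The rows of the curve carry the factors [t ^- n k] and [t ^+ n k]; taking the first one out
   leaves the exponent [n k + n k]. *)
- exists (- (n k)%:Z), (fun g => (SL2val (g k) a 0 * SL2val (basept R k) 0 c)%:P +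
    (SL2val (g k) a 1 * SL2val (basept R k) 1 c)%:P * 'X^(n k + n k)).
  split=> [l|g t t0].
    under eq_fun do rewrite coefD coefC coefCM.
    apply: poly_add.
      case: (l == 0); last exact: poly_cst.
      by apply: poly_mul; [exact: poly_entry | exact: poly_cst].
    apply: poly_mul; last exact: poly_cst.
    by apply: poly_mul; [exact: poly_entry | exact: poly_cst].
  rewrite GmulE mxE2 !curveE ?expf_neq0 // /sgnpow /= hornerD hornerM !hornerC.
  rewrite hornerXn -exprnN exprD; field; exact: expf_neq0.
- exists (Num.min m m'); apply: order_geD.
  + by apply: order_ge_weaken mf; rewrite ge_min lexx.
  + by apply: order_ge_weaken mf'; rewrite ge_min lexx orbT.
- exists (m + m'), (fun g => Q g * Q' g); exact: expansionM.
Qed.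

Lemma poly_eq_punctured (p q : {poly C}) :
  (forall t, t != 0 -> p.[t] = q.[t]) -> p = q.
Proof.
move=> pq; have /eqP : (p - q) * 'X = 0.
  apply: poly_zero => t; rewrite hornerM hornerX hornerD hornerN.
  by have [->|t0] := eqVneq t 0; rewrite ?mulr0 // pq // subrr mul0r.
by rewrite mulf_eq0 polyX_eq0 orbF subr_eq0 => /eqP.
Qed.

(** If [m'] exceeded [m], then [Q g] would be divisible by ['X] for every [g], against its nonzero
    constant coefficient. *)
Lemma order_max F m m' : order F m -> order_ge F m' -> m' <= m.
Proof.
move=> [Q [_ FQ] [g Qg]] [Q' [_ FQ']]; rewrite leNgt; apply/negP => mm'.
have [d dE] : exists d : nat, m' = m + d.+1%:Z.
  exists `|m' - m|.-1%N; rewrite prednK ?absz_gt0 ?subr_eq0 ?gt_eqF //.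
  by rewrite gtz0_abs ?subr_gt0 // [RHS]addrC subrK.
have QE : Q g = Q' g * 'X^(d.+1).
  apply: poly_eq_punctured => t t0; apply: (mulfI (expfz_neq0 m t0)).
  by rewrite -FQ // FQ' // dE expfzDr // hornerM hornerXn mulrA mulrAC.
by move: Qg; rewrite QE coefMXn eqxx.
Qed.

Lemma order_inj F m m' : order F m -> order F m' -> m = m'.
Proof.
move=> Fm Fm'; apply/eqP; rewrite eq_le.
by rewrite (order_max Fm' (order_order_ge Fm)) (order_max Fm (order_order_ge Fm')).
Qed.

Lemma order_exists F g : polynomialG F -> F g != 0 -> exists m, order F m.
Proof.
move=> /order_ge_polynomialG [m [Q [PQ FQ]]] Fg.
have exl : exists l, `[< exists g, (Q g)`_l != 0 >].
  apply: contrapT => nex; move/eqP: Fg; apply.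
  rewrite -[g](mulgVK (crv 1)) FQ ?oner_eq0 // (_ : Q _ = 0) ?horner0 ?mulr0 //.
  apply/polyP => l; rewrite coef0; apply: contrapT => /eqP Ql.
  by apply: nex; exists l; apply/asboolP; eexists; exact: Ql.
(* [l] is the least index whose coefficient is not identically zero in [g]; dividing by ['X^l]
   leaves a generically nonzero constant coefficient. *)
case: (ex_minnP exl) => l /asboolP Ql lmin.
exists (m + l%:Z), (fun g => drop_poly l (Q g)); last first.
  by have [h Qh] := Ql; exists h; rewrite coef_drop_poly add0n.
split=> [k|h t t0]; first by under eq_fun do rewrite coef_drop_poly; exact: PQ.
rewrite FQ // expfzDr // -mulrA -exprnP [_ ^+ l * _]mulrC; congr (_ * _).
rewrite -[t ^+ l]hornerXn -hornerM; congr (_.[_]).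
rewrite -[LHS](poly_take_drop l) (_ : take_poly l _ = 0) ?add0r //.
apply/polyP => k; rewrite coef_take_poly coef0; case: ltnP => // kl.
apply: contrapT => /eqP Qk; move: kl; rewrite ltnNge => /negP; apply.
by apply: lmin; apply/asboolP; exists h.
Qed.

(** The constant coefficients multiply, and two nonzero regular functions on [G] have a common point
    where neither vanishes. *)
Lemma order_mul F F' m m' : order F m -> order F' m' ->
  order (fun g => F g * F' g) (m + m').
Proof.
move=> [Q [PQ FQ] [g Qg]] [Q' [PQ' FQ'] [g' Qg']].
exists (fun g => Q g * Q' g); first exact: expansionM.
have [h Qh] := polynomialG_integral (PQ 0%N) (PQ' 0%N) Qg Qg'.
by exists h; rewrite coef0M.
Qed.

(** Orders are taken over all translates [g] at once, so replacing [g] by [h * g] changes nothing;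
    this is the invariance of the valuation. *)
Lemma order_transl F m h : order F m -> order (fun g => F (h * g)%g) m.
Proof.
move=> [Q [PQ FQ] [g Qg]]; exists (fun g => Q (h * g)%g).
  split=> [l|k t t0]; last by rewrite mulgA FQ.
  exact: (polynomialG_transl h (PQ l)).
by exists (h^-1 * g)%g; rewrite mulVKg.
Qed.

Lemma order_cst c : c != 0 -> order (fun=> c) 0.
Proof.
move=> c0; exists (fun=> c%:P); last by exists 1%g; rewrite coefC.
by split=> [l|g t t0]; [exact: poly_cst | rewrite expr0z mul1r hornerC].
Qed.

Lemma order_minor (i j : 'I_3) : (i < j)%N ->
  order (minor i j 0 0) (- (n i + n j)%N%:Z).
Proof.
move=> ij; pose Q (g : G) : {poly C} := \sum_(p < 2) \sum_(q < 2)
  (SL2val (g i) 0 p * SL2val (g j) 0 q * minor i j p q (basept R))%:P *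
  'X^((n i + n i) * p + (n j + n j) * q).
exists Q; last first.
  (* At the identity only the term [p = q = 0] survives, even when [n i] or [n j] is 0 and other
     terms have exponent 0 too. *)
  exists 1%g; rewrite /Q !sum2E !ffunE !mxE /=.
  rewrite !(mul0r, mul1r, polyC0, addr0, muln0) expr0 mulr1 coefC /=.
  by rewrite -pluckerE basept_plucker // oner_eq0.
split=> [l|g t t0].
  under eq_fun do rewrite coef_sum; apply: polynomialG_sum => p.
  under eq_fun do rewrite coef_sum; apply: polynomialG_sum => q.
  under eq_fun do rewrite coefCM.
  apply: poly_mul; last exact: poly_cst.
  apply: poly_mul; last exact: poly_cst.
  by apply: poly_mul; exact: poly_entry.
have s0 k : t ^+ n k != 0 by exact: expf_neq0.
rewrite minor_mul /Q !sum2E !(minor_curve _ _ _ _ s0).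
rewrite /sgnpow /= !hornerD !hornerM !hornerC !hornerXn !muln0 !muln1 add0n addn0.
rewrite -exprnN !exprD expr0; field.
by rewrite !expf_neq0.
Qed.

Definition ordA (f : A) : int := xget 0 [set m | order (fun g => f (piGH g)) m].

Lemma ordAE (f : A) m : order (fun g => f (piGH g)) m -> ordA f = m.
Proof. by move=> fm; apply: xget_unique => // m' /order_inj; exact. Qed.

Lemma ordAP (f : A) : f != 0 -> order (fun g => f (piGH g)) (ordA f).
Proof.
move=> f0; apply: (@xgetPex _ _ [set m | order (fun g => f (piGH g)) m]).
have [g fg] : exists g, f (piGH g) != 0.
  apply: contrapT => nex; move/eqP: f0; apply; apply: coord_ext => g.
  by apply: contrapT => /eqP fg; apply: nex; exists g.
exact: order_exists (coordP f) fg.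
Qed.

Lemma ordAM (f f' : A) : f != 0 -> f' != 0 -> ordA (f * f') = ordA f + ordA f'.
Proof. by move=> f0 f'0; apply: ordAE; apply: order_mul; exact: ordAP. Qed.

Lemma ordAD (f f' : A) : f != 0 -> f' != 0 -> f + f' != 0 ->
  Num.min (ordA f) (ordA f') <= ordA (f + f').
Proof.
move=> /ordAP fo /ordAP f'o /ordAP ff'o; apply: order_max ff'o _.
apply: order_geD; apply: order_ge_weaken (order_order_ge _); try eassumption.
- by rewrite ge_min lexx.
- by rewrite ge_min lexx orbT.
Qed.

Lemma ordA_act g (f : A) : f != 0 -> ordA (coord_act g f) = ordA f.
Proof.
move=> /ordAP fo; apply: ordAE.
under eq_fun do rewrite coord_actE; exact: (order_transl g^-1%g fo).
Qed.

Lemma ordA_cst c : c != 0 -> ordA (c%:A) = 0.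
Proof.
move=> c0; apply: ordAE.
rewrite (_ : (fun _ => _) = fun=> c); first exact: order_cst.
by apply/funext => g; rewrite coordZE mulr1.
Qed.

Lemma ordA_plucker (i j : 'I_3) : (i < j)%N ->
  ordA (plucker R i j 0 0) = - (n i + n j)%N%:Z.
Proof.
move=> ij; apply: ordAE; under eq_fun do rewrite pluckerE; exact: order_minor.
Qed.

End CurveOrder.

(** * Invariant valuations *)

Section Valuations.
Variable R : realType.
Local Notation C := R[i].
Local Notation G := (G R).
Local Notation A := (coordRing R).
Local Notation K := (ratFun R).
Local Notation "x %:F" := (FracField.tofrac x : K).

Lemma tofrac_neq0 (f : A) : f != 0 -> f%:F != 0.
Proof. by rewrite tofrac_eq0. Qed.

Lemma fracP (x : K) : x != 0 ->
  exists a b : A, [/\ a != 0, b != 0 & x = a%:F / b%:F].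
Proof.
move=> x0; exists (\n_(repr x))%R, (\d_(repr x))%R; have xE := frac_numden x.
split=> //; last exact: denom_ratioP.
by apply: contraNneq x0 => n0; rewrite xE n0 tofrac0 mul0r.
Qed.

Section Inequalities.
Variable v : K -> rat.
Hypotheses (dv : discrete_valuation v) (Gv : G_invariant v).

Lemma val_scale c (f : A) : c != 0 -> f != 0 -> v (c *: f)%:F = v f%:F.
Proof.
move=> c0 f0; have [vM _ vC _] := dv.
have cA : c%:A != 0 :> A by rewrite scaler_eq0 negb_or c0 oner_eq0.
by rewrite -[f in LHS]mul1r scalerAl tofracM vM ?tofrac_neq0 // vC // add0r.
Qed.

Lemma val_act g (f : A) : f != 0 -> v (coord_act g f)%:F = v f%:F.
Proof.
move=> f0; rewrite -(Gv g (tofrac_neq0 f0)).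
have -> : f%:F = f%:F / (1 : A)%:F by rewrite tofrac1 divr1.
rewrite frac_actE ?oner_eq0 //.
by rewrite (_ : coord_act g 1 = 1) ?tofrac1 ?divr1 //; apply: coord_ext.
Qed.

(** The Weyl elements carry the minors into one another, and [v] is invariant. *)
Lemma val_plucker i j a b : i != j ->
  v (plucker R i j a b)%:F = v (plucker R i j 0 0)%:F.
Proof.
move=> ij; have nz c d := plucker_neq0 R c d ij.
have va c : v (plucker R i j 1 c)%:F = v (plucker R i j 0 c)%:F.
  by rewrite -(act_weyl R ij c).1 val_act.
have vb c : v (plucker R i j c 1)%:F = v (plucker R i j c 0)%:F.
  by rewrite -(act_weyl' R ij c).1 val_act.
by move: a b; apply: ord2P; apply: ord2P; rewrite ?va ?vb.
Qed.

Lemma val_hwv (i j : 'I_3) : (i < j)%N ->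
  v (highestWeightVector R (Omega i j))%:F = v (plucker R i j 0 0)%:F.
Proof.
move=> ij; have ij' : i != j by rewrite -val_eqE neq_ltn ij.
have hw : highest_weight_vector (Omega i j) (highestWeightVector R (Omega i j)).
  apply: (@xgetPex _ _ [set f : A | highest_weight_vector (Omega i j) f]).
  by exists (plucker R i j 0 0); exact: plucker_hwv.
have [c c0 ->] := hwv_Omega ij hw.
by rewrite val_scale // plucker_neq0.
Qed.

Lemma plucker_anti i j a b : plucker R j i b a = - plucker R i j a b.
Proof.
by apply: coord_ext => g; rewrite -scaleN1r coordZE !pluckerE /minor; ring.
Qed.

Lemma val_pluckerC i j : i != j ->
  v (plucker R j i 0 0)%:F = v (plucker R i j 0 0)%:F.
Proof.
move=> ij; rewrite plucker_anti -scaleN1r val_scale ?plucker_neq0 //.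
by rewrite oppr_eq0 oner_eq0.
Qed.

(* The rows of the [i]-th matrix form a basis of determinant 1, so the minor of
   [p] and [q] is the determinant of their coordinates in that basis. *)
Lemma plucker_relation i j k a b : plucker R j k a b =
  plucker R i j 0 a * plucker R i k 1 b - plucker R i j 1 a * plucker R i k 0 b.
Proof.
apply: coord_ext => g; rewrite coordBE !coordME !pluckerE /minor.
by rewrite -[LHS]mul1r -(SL2_det (g i)); ring.
Qed.

Lemma val_add_mul (x y z w s : K) : x != 0 -> y != 0 -> z != 0 -> w != 0 ->
  s != 0 -> s = x * y + z * w -> Num.min (v x + v y) (v z + v w) <= v s.
Proof.
move=> x0 y0 z0 w0 s0 sE; have [vM vD _ _] := dv.
rewrite -(vM x y x0 y0) -(vM z w z0 w0).
rewrite sE.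
rewrite sE in s0.
have xy := mulf_neq0 x0 y0.
have zw := mulf_neq0 z0 w0.
exact: (vD _ _ xy zw s0).
Qed.

(** By [val_plucker] both products in [plucker_relation] have the same value, the left-hand side
    here, and the ultrametric inequality applies. *)
Lemma val_triangle i j k : i != j -> i != k -> j != k ->
  v (plucker R i j 0 0)%:F + v (plucker R i k 0 0)%:F <= v (plucker R j k 0 0)%:F.
Proof.
move=> ij ik jk.
have nz k1 k2 a b : k1 != k2 -> (plucker R k1 k2 a b)%:F != 0.
  by move=> k12; rewrite tofrac_neq0 // plucker_neq0.
have E : (plucker R j k 0 0)%:F = (plucker R i j 0 0)%:F * (plucker R i k 1 0)%:F
    + (- plucker R i j 1 0)%:F * (plucker R i k 0 0)%:F.
  by rewrite -!tofracM -tofracD mulNr -plucker_relation.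
have nN : (- plucker R i j 1 0)%:F != 0 by rewrite tofracN oppr_eq0 nz.
have := val_add_mul (nz _ _ _ _ ij) (nz _ _ _ _ ik) nN (nz _ _ _ _ ik) (nz _ _ _ _ jk) E.
rewrite (val_plucker 1 0 ik) -plucker_anti (val_plucker 0 1) 1?eq_sym //.
by rewrite (val_pluckerC ij) minxx.
Qed.

End Inequalities.

Section CurveValuation.
Variables (n : 'I_3 -> nat) (q : rat).
Hypothesis q_ge0 : 0 <= q.

(** The factor [q] turns integral orders into rational values; its sign preserves the ultrametric
    inequality. *)
Definition curve_val (x : K) : rat :=
  (ordA n \n_(repr x) - ordA n \d_(repr x))%:~R * q.

Lemma curve_valE (a b : A) : a != 0 -> b != 0 ->
  curve_val (a%:F / b%:F) = (ordA n a - ordA n b)%:~R * q.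
Proof.
move=> a0 b0; set x := a%:F / b%:F; rewrite /curve_val.
congr (_%:~R * _); have xE : x = _ := frac_numden x.
have d0 : \d_(repr x) != 0 := denom_ratioP _.
have n0 : \n_(repr x) != 0.
  have : x != 0 by rewrite mulf_neq0 ?invr_eq0 ?tofrac_neq0.
  by apply: contraNneq => n0; rewrite xE n0 tofrac0 mul0r.
have /(congr1 (ordA n)) : a * \d_(repr x) = \n_(repr x) * b.
  apply/eqP; rewrite -tofrac_eq !tofracM.
  by rewrite -eqr_div ?tofrac_neq0 //; apply/eqP; exact: xE.
rewrite !ordAM // => /eqP; rewrite addrC -subr_eq -addrA => /eqP <-; ring.
Qed.

Lemma ordA1 : ordA n (1 : A) = 0.
Proof. by rewrite -(scale1r (1 : A)) ordA_cst ?oner_eq0. Qed.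

Lemma curve_val_tofrac (a : A) : a != 0 -> curve_val a%:F = (ordA n a)%:~R * q.
Proof.
move=> a0; have -> : a%:F = a%:F / (1 : A)%:F by rewrite tofrac1 divr1.
by rewrite curve_valE ?oner_eq0 // ordA1 subr0.
Qed.

Lemma discrete_curve_val : discrete_valuation curve_val.
Proof.
split.
- move=> _ _ /fracP[a [b [a0 b0 ->]]] /fracP[c [d [c0 d0 ->]]].
  rewrite mulf_div -!tofracM !curve_valE ?mulf_neq0 // !ordAM //.
  rewrite -mulrDl -rmorphD /=; congr (_%:~R * _); ring.
- move=> _ _ /fracP[a [b [a0 b0 ->]]] /fracP[c [d [c0 d0 ->]]].
  rewrite addf_div ?tofrac_neq0 // -!tofracM -tofracD => xy0.
  have s0 : a * d + c * b != 0.
    by apply: contraNneq xy0 => ->; rewrite tofrac0 mul0r.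
  rewrite !curve_valE ?mulf_neq0 // ge_min.
  have := ordAD n (mulf_neq0 a0 d0) (mulf_neq0 c0 b0) s0.
  rewrite !ordAM // ge_min => /orP[le|le]; apply/orP; [left|right];
    rewrite ler_wpM2r // ler_int;
    move: (ordA n (_ + _)) (ordA n a) (ordA n b) (ordA n c) (ordA n d) le;
    by clear; move=> *; lia.
- move=> c c0; have cA : c%:A != 0 :> A by rewrite scaler_eq0 negb_or c0 oner_eq0.
  by rewrite curve_val_tofrac // ordA_cst // mul0r.
- by exists q => _ /fracP[a [b [a0 b0 ->]]]; rewrite curve_valE //; eexists.
Qed.

Lemma G_invariant_curve_val : G_invariant curve_val.
Proof.
move=> g _ /fracP[a [b [a0 b0 ->]]].
by rewrite frac_actE // !curve_valE ?coord_act_eq0 // !ordA_act.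
Qed.

Lemma valuationCone_curve : valuationCone R
  (vec3 (- ((n 0%R + n 1%R)%N%:R * q)) (- ((n 0%R + n 2%R)%N%:R * q))
    (- ((n 1%R + n 2%R)%N%:R * q))).
Proof.
exists curve_val; split; [exact: discrete_curve_val | exact: G_invariant_curve_val |].
have E (i j : 'I_3) : (i < j)%N ->
    curve_val (highestWeightVector R (Omega i j))%:F = - ((n i + n j)%N%:R * q).
  move=> ij; rewrite (val_hwv discrete_curve_val) //.
  rewrite curve_val_tofrac ?plucker_neq0 -?val_eqE ?neq_ltn ?ij // ordA_plucker //.
  by rewrite rmorphN mulNr.
by move=> f; congr vec3; apply/esym; exact: E.
Qed.

End CurveValuation.

(** These are the cases of [val_triangle] whose shared index is 0, 1 and 2 in turn. *)
Lemma valuationCone_le u : valuationCone R u ->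
  [/\ u 0 0 + u 0 1 <= u 0 2, u 0 0 + u 0 2 <= u 0 1 & u 0 1 + u 0 2 <= u 0 0].
Proof.
move=> [v [dv Gv ->]]; rewrite !mxE /= !val_hwv //.
split.
- exact: val_triangle.
- by rewrite -(val_pluckerC dv (i := 0) (j := 1)) //; exact: val_triangle.
- rewrite -(val_pluckerC dv (i := 0) (j := 2)) // -(val_pluckerC dv (i := 1) (j := 2)) //.
  exact: val_triangle.
Qed.

End Valuations.

(** * The spherical logarithm and the cone *)

Section Chord.
Variable R : realType.
Local Notation C := R[i].
Local Notation G := (G R).
Local Notation GH := (GH R).
Local Notation nsq z := (Normc.normc z ^+ 2).

Lemma normc2E (a b : R) : nsq (a +i* b)%C = a ^+ 2 + b ^+ 2.
Proof. by rewrite sqr_sqrtr ?addr_ge0 ?sqr_ge0. Qed.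

Lemma normc2M (z w : C) : nsq (z * w) = nsq z * nsq w.
Proof. by rewrite Normc.normcM exprMn. Qed.

Lemma normc2N (z : C) : nsq (- z) = nsq z.
Proof. by case: z => a b; rewrite -[(- _)%R]/((- a +i* - b)%C) !normc2E !sqrrN. Qed.

Lemma normc2_cauchy (u v w z : C) :
  nsq (u * v - w * z) <= (nsq u + nsq w) * (nsq z + nsq v).
Proof.
case: u v w z => [a b] [c d] [e f] [g h].
rewrite -[(_ - _)%R]/((((a * c - b * d) - (e * g - f * h)) +i*
  ((a * d + b * c) - (e * h + f * g)))%C) !normc2E -subr_ge0.
(* Lagrange's identity: the defect in the Cauchy-Schwarz inequality is the squared modulus of [u]
   times the conjugate of [z] plus [w] times the conjugate of [v]. *)
suff -> : (a ^+ 2 + b ^+ 2 + (e ^+ 2 + f ^+ 2)) * (g ^+ 2 + h ^+ 2 + (c ^+ 2 + d ^+ 2)) -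
  ((a * c - b * d - (e * g - f * h)) ^+ 2 + (a * d + b * c - (e * h + f * g)) ^+ 2) =
  (a * g + b * h + e * c + f * d) ^+ 2 + (b * g - a * h + f * c - e * d) ^+ 2.
  by rewrite addr_ge0 ?sqr_ge0.
ring.
Qed.

Lemma chordC i j x : chord j i x = chord i j x :> R.
Proof.
rewrite /chord exchange_big; congr (_ * _).
apply: eq_bigr => a _; apply: eq_bigr => b _.
by rewrite (plucker_anti R i j) -scaleN1r coordZE mulN1r normc2N.
Qed.

(** The matrix of the four minors is the product of the [i]-th matrix, a Weyl element and the
    transpose of the [j]-th matrix; it has determinant 1 and cannot vanish. Positivity is what makes
    the logarithms behave. *)
Lemma chord_gt0 i j x : 0 < chord i j x :> R.
Proof.
have S0 : 0 <= \sum_a \sum_b nsq (plucker R i j a b x).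
  by apply: sumr_ge0 => a _; apply: sumr_ge0 => b _; exact: sqr_ge0.
rewrite /chord mulr_gt0 ?invr_gt0 // lt_neqAle S0 andbT eq_sym; apply/negP => Z.
have P a b : plucker R i j a b x = 0.
  apply: Normc.eq0_normc; apply/eqP; rewrite -sqrf_eq0.
  move: Z; rewrite psumr_eq0 => [/allP/(_ a)|c _]; last first.
    by apply: sumr_ge0 => d _; exact: sqr_ge0.
  rewrite mem_index_enum => /(_ isT) /=.
  rewrite psumr_eq0 => [/allP/(_ b)|c _]; last exact: sqr_ge0.
  by rewrite mem_index_enum => /(_ isT).
have xE : x = piGH (repr x) by rewrite /piGH reprK.
have M a b : minor i j a b (repr x) = 0 by rewrite -pluckerE -xE.
have : minor i j 0 0 (repr x) * minor i j 1 1 (repr x) -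
       minor i j 0 1 (repr x) * minor i j 1 0 (repr x) = 1.
  rewrite /minor -[RHS](mulr1 1) -{1}(SL2_det (repr x i)) -(SL2_det (repr x j)).
  ring.
by rewrite !M !mul0r subrr => /eqP; rewrite eq_sym oner_eq0.
Qed.

(** Cauchy-Schwarz bounds each term of [plucker_relation]; summed over [a] and [b], the bounds
    factor into [2 * chord i j x] times [2 * chord i k x], and the normalisation on the left halves
    the constant 4. *)
Lemma chord_triangle i j k x :
  chord j k x <= 2 * (chord i j x * chord i k x) :> R.
Proof.
have le a b : nsq (plucker R j k a b x) <=
    (nsq (plucker R i j 0 a x) + nsq (plucker R i j 1 a x)) *
    (nsq (plucker R i k 0 b x) + nsq (plucker R i k 1 b x)).
  by rewrite (plucker_relation R i) coordBE !coordME; exact: normc2_cauchy.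
rewrite /chord !sum2E.
have := le 0 0; have := le 0 1; have := le 1 0; have := le 1 1.
lra.
Qed.

Lemma normc2_basept (i j : 'I_3) a b : (i < j)%N ->
  nsq (minor i j a b (basept R)) <= 1.
Proof.
move=> ij; have n0 : nsq (0 : C) = 0 by rewrite Normc.normc0 expr0n.
have n1 : nsq (1 : C) = 1 by rewrite Normc.normc1 expr1n.
have nN1 : nsq (- 1 : C) = 1 by rewrite normc2N.
suff : [\/ minor i j a b (basept R) = 0, minor i j a b (basept R) = 1 |
    minor i j a b (basept R) = - 1].
  by case=> ->; rewrite ?n0 ?n1 ?nN1.
have [e0 e1 e2] := baseptE R.
move: i j ij; apply: ord3P; apply: ord3P => // _; rewrite /minor ?e0 ?e1 ?e2;
  move: a b; apply: ord2P; apply: ord2P; rewrite !mxE /=;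
  by [apply: Or31; ring | apply: Or32; ring | apply: Or33; ring].
Qed.

Lemma normc2_real (s : R) : nsq (s%:C)%C = s ^+ 2.
Proof. by rewrite normc2E expr0n addr0. Qed.

(** The top-row minor contributes exactly [T], and as each [s k] is at most 1 no other minor
    contributes more, so the sum lies between [T] and [4 T]. *)
Lemma chord_curve (i j : 'I_3) (s : 'I_3 -> R) (x := piGH (curve (fun k => (s k)%:C)%C))
    (T := ((s i * s j) ^+ 2)^-1) :
  (i < j)%N -> (forall k, 0 < s k <= 1) ->
  T / 2 <= chord i j x <= 2 * T.
Proof.
move=> ij s01; have s0 k : 0 < s k by have /andP[] := s01 k.
have sC k : (s k)%:C%C != 0 :> C by rewrite eq_complex /= gt_eqF.
have T0 : 0 < T by rewrite invr_gt0 exprn_gt0 // mulr_gt0.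
pose w a k := nsq (sgnpow a (s k)%:C%C).
have w0 k : w 0 k = (s k ^+ 2)^-1.
  by rewrite /w /sgnpow eqxx Normc.normcV exprVn normc2_real.
have w1 k : w 1 k = s k ^+ 2 by exact: normc2_real.
have w_le a k : 0 <= w a k <= w 0 k.
  rewrite {1}/w sqr_ge0 /=; move: a; apply: ord2P => //; rewrite w1 w0.
  have /andP[_ s1] := s01 k; have s21 : s k ^+ 2 <= 1 by rewrite exprn_ile1 // ltW.
  by rewrite (le_trans s21) // invf_ge1 // exprn_gt0.
have DE a b : nsq (plucker R i j a b x) = w a i * w b j * nsq (minor i j a b (basept R)).
  by rewrite pluckerE (minor_curve _ _ _ _ sC) !normc2M.
have TE : T = w 0 i * w 0 j by rewrite !w0 /T exprMn invfM.
have D_le a b : nsq (plucker R i j a b x) <= T.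
  rewrite DE TE -[leRHS]mulr1; have /andP[? ?] := w_le a i; have /andP[? ?] := w_le b j.
  have ww : 0 <= w a i * w b j by exact: mulr_ge0.
  by apply: ler_pM; [|exact: sqr_ge0|exact: ler_pM|exact: normc2_basept].
have D00 : nsq (plucker R i j 0 0 x) = T.
  by rewrite DE -pluckerE basept_plucker // Normc.normc1 expr1n mulr1 TE.
have D_ge a b : 0 <= nsq (plucker R i j a b x) by exact: sqr_ge0.
rewrite /chord !sum2E D00.
have := D_ge 0 1; have := D_ge 1 0; have := D_ge 1 1.
have := D_le 0 1; have := D_le 1 0; have := D_le 1 1.
by move=> *; apply/andP; split; lra.
Qed.

End Chord.

Section Cones.
Variable R : realType.
Local Notation cone :=
  (cone3 (vec3 (-1) (-1) 0) (vec3 (-1) 0 (-1)) (vec3 0 (-1) (-1)) : set 'rV[R]_3).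

Lemma vec3E (T : nmodType) (a b c : T) :
  [/\ vec3 a b c 0 0 = a, vec3 a b c 0 1 = b & vec3 a b c 0 2 = c].
Proof. by split; rewrite mxE. Qed.

Lemma cone3P (y : 'rV[R]_3) : cone y <->
  [/\ y 0 0 + y 0 1 <= y 0 2, y 0 0 + y 0 2 <= y 0 1 & y 0 1 + y 0 2 <= y 0 0].
Proof.
split=> [[a [b [c [a0 b0 c0 ->]]]]|[y0 y1 y2]].
  by rewrite !mxE /=; split; lra.
(* The slack in each inequality is twice one coefficient. *)
exists ((y 0 2 - y 0 0 - y 0 1) / 2), ((y 0 1 - y 0 0 - y 0 2) / 2),
  ((y 0 0 - y 0 1 - y 0 2) / 2); split; [lra|lra|lra|].
by apply/rowP; apply: ord3P; rewrite !mxE /=; field.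
Qed.

Lemma ball_rV3 (y z : 'rV[R]_3) e : 0 < e -> ball y e z <->
  [/\ `|y 0 0 - z 0 0| < e, `|y 0 1 - z 0 1| < e & `|y 0 2 - z 0 2| < e].
Proof.
move=> e0; split=> [[_ h]|[h0 h1 h2]]; first by split; exact: h.
split=> // i; rewrite ord1; exact: ord3P.
Qed.

Lemma cone3_nbhsN (y : 'rV[R]_3) : ~ cone y -> exists2 U, nbhs y U &
  exists2 d : R, 0 < d & forall z, U z ->
    [\/ d <= z 0 0 + z 0 1 - z 0 2, d <= z 0 0 + z 0 2 - z 0 1 |
        d <= z 0 1 + z 0 2 - z 0 0].
Proof.
move=> Ny.
have near d : 0 < d -> forall z, ball y (d / 4) z ->
    [/\ y 0 0 - d / 4 < z 0 0 < y 0 0 + d / 4, y 0 1 - d / 4 < z 0 1 < y 0 1 + d / 4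
      & y 0 2 - d / 4 < z 0 2 < y 0 2 + d / 4].
  move=> d0 z /ball_rV3 []; first by rewrite divr_gt0.
  by rewrite ![`|y _ _ - _|]distrC !ltr_distl.
(* [d] is the largest violation. Each inequality involves three coordinates, so moving each by less
   than [d / 4] leaves a violation of at least [d / 4]. *)
pose d := Num.max (y 0 0 + y 0 1 - y 0 2) (Num.max (y 0 0 + y 0 2 - y 0 1)
  (y 0 1 + y 0 2 - y 0 0)).
have d0 : 0 < d.
  rewrite ltNge; apply/negP; rewrite !ge_max => /and3P[? ? ?]; apply: Ny.
  by apply/cone3P; split; lra.
exists (ball y (d / 4)); first by apply: nbhsx_ballx; rewrite divr_gt0.
exists (d / 4); first by rewrite divr_gt0.
move=> z /(near _ d0) [/andP[? ?] /andP[? ?] /andP[? ?]].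
have : [|| d <= y 0 0 + y 0 1 - y 0 2, d <= y 0 0 + y 0 2 - y 0 1 |
           d <= y 0 1 + y 0 2 - y 0 0].
  by rewrite -!le_max lexx.
by case/or3P => ?; [apply: Or31|apply: Or32|apply: Or33]; lra.
Qed.

Lemma realValuationCone_sub : realValuationCone R `<=` cone.
Proof.
move=> y cy; apply: contrapT => /cone3_nbhsN [U Uy [d d0 hU]].
have [_ [[u /valuationCone_le [u0 u1 u2] <-] /hU]] := cy _ Uy.
move: u0 u1 u2; rewrite -3!(ler_rat R) !rmorphD !mxE /=.
by move=> ? ? ?; case=> ?; lra.
Qed.

Lemma cone_sub_realValuationCone : cone `<=` realValuationCone R.
Proof.
move=> y [a0 [a1 [a2 [? ? ?]]]].
pose a (k : 'I_3) : R := if k == 0 then a0 else if k == 1 then a1 else a2.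
have a_ge0 k : 0 <= a k by move: k; apply: ord3P.
move=> yE U /nbhs_ballP [e /= e0 yU].
(* Each coordinate is minus a sum of two of the [a k]. Rounding these down to multiples of
   [1 / N.+1] moves it by less than [2 / N.+1], which has to be below [e]. *)
pose N := (Num.bound (2 / e)).
have N0 : (0 : R) < N.+1%:R by rewrite ltr0n.
have N_big : 2 / N.+1%:R < e.
  rewrite ltr_pdivrMr // mulrC -ltr_pdivrMr //.
  have b0 : 0 <= 2 / e by rewrite divr_ge0 // ltW.
  rewrite (lt_trans (archi_boundP b0)) // ltr_nat; exact: ltnSn.
pose n k := Num.truncn (a k * N.+1%:R).
have nP k : a k - 1 / N.+1%:R < (n k)%:R / N.+1%:R <= a k.
  have an0 : 0 <= a k * N.+1%:R by rewrite mulr_ge0 // ltW.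
  have /andP[le lt] := truncn_itv an0.
  rewrite ler_pdivrMr // le andbT ltrBlDr -mulrDl ltr_pdivlMr //.
  by rewrite natr1.
have q0 : 0 <= (N.+1%:R)^-1 :> rat by rewrite invr_ge0 ler0n.
have VC := valuationCone_curve R n q0.
eexists; split; first exact: (imageP _ VC).
apply: yU; apply/ball_rV3 => //; rewrite yE !mxE /=.
have rE (m : nat) : ratr (- (m%:R * N.+1%:R^-1)) = - (m%:R / N.+1%:R) :> R.
  by rewrite rmorphN rmorphM fmorphV !rmorph_nat.
rewrite !rE !natrD.
have /andP[] := nP 0; have /andP[] := nP 1; have /andP[] := nP 2.
rewrite /a /= => l2 u2 l1 u1 l0 u0.
have E2 : 2 / N.+1%:R = 1 / N.+1%:R + 1 / N.+1%:R :> R by rewrite -mulrDl.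
rewrite E2 in N_big.
rewrite !mulrDl; move: l2 u2 l1 u1 l0 u0 N_big.
move: ((n 0)%:R / _) ((n 1)%:R / _) ((n 2)%:R / _) (1 / _) => x0 x1 x2 h *.
by split; rewrite ltr_norml; apply/andP; split; lra.
Qed.

Lemma realValuationConeE : realValuationCone R = cone.
Proof.
by apply/seteqP; split; [exact: realValuationCone_sub|exact: cone_sub_realValuationCone].
Qed.

Lemma sLogE (t : R) x : sLog t x = vec3 (ln (chord 0 1 x) / ln t)
  (ln (chord 0 2 x) / ln t) (ln (chord 1 2 x) / ln t).
Proof. by rewrite /sLog !sphericalFunctionE. Qed.

(** The threshold is the [t] at which the error [ln 2 / (- ln t)] equals [d]. *)
Lemma ln_small (t d : R) : 0 < d -> 0 < t < expR (- (ln 2 / d)) ->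
  ln t < 0 /\ ln 2 / (- ln t) < d.
Proof.
move=> d0 /andP[t0 te]; have l2 : 0 < ln 2 :> R by rewrite ln_gt0 // ltr1n.
have lt : ln t < - (ln 2 / d) by rewrite -[ltRHS]expRK ltr_ln ?posrE ?expR_gt0.
have lt0 : ln t < 0 by rewrite (lt_trans lt) // oppr_lt0 divr_gt0.
split=> //; rewrite ltr_pdivrMr ?oppr_gt0 // mulrC -ltr_pdivrMr //.
by rewrite ltrNr.
Qed.

Lemma ln_chord_triangle i j k x :
  ln (chord j k x) <= ln 2 + (ln (chord i j x) + ln (chord i k x)) :> R.
Proof.
have [c1 c2 c3] := And3 (chord_gt0 j k x) (chord_gt0 i j x) (chord_gt0 i k x).
have c23 : 0 < chord i j x * chord i k x by exact: mulr_gt0.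
have p2 : 0 < 2 * (chord i j x * chord i k x) by exact: mulr_gt0.
have := chord_triangle i j k x; rewrite -(ler_ln c1 p2).
by rewrite (lnM (_ : 2 \is Num.pos) c23) ?(lnM c2 c3) ?posrE.
Qed.

(** Dividing [ln_chord_triangle] by the negative number [ln t] reverses it and leaves the error
    [ln 2 / (- ln t)]. *)
Lemma sLog_defect (t d : R) x : 0 < d -> 0 < t < expR (- (ln 2 / d)) ->
  let z := sLog t x in [/\ z 0 0 + z 0 1 - z 0 2 < d,
    z 0 0 + z 0 2 - z 0 1 < d & z 0 1 + z 0 2 - z 0 0 < d].
Proof.
move=> d0 td; have [lt0 ltd] := ln_small d0 td; rewrite sLogE /=.
have [-> -> ->] := vec3E (ln (chord 0 1 x) / ln t) (ln (chord 0 2 x) / ln t)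
  (ln (chord 1 2 x) / ln t).
have le (p q r : R) : r <= ln 2 + (p + q) -> p / ln t + q / ln t - r / ln t < d.
  move=> h; apply: le_lt_trans ltd; rewrite invrN mulrN -mulNr -!mulrDl -mulrBl.
  by rewrite ler_nM2r ?invr_lt0 //; lra.
split; apply: le.
- exact: ln_chord_triangle.
- by rewrite -(chordC 0 1); exact: ln_chord_triangle.
- by rewrite -(chordC 0 2) -(chordC 1 2); exact: ln_chord_triangle.
Qed.

Lemma sLog_dense (y : 'rV[R]_3) (d t : R) : cone y -> 0 < d ->
  0 < t < expR (- (ln 2 / d)) -> exists x, ball y d (sLog t x).
Proof.
move=> [a0 [a1 [a2 [? ? ?]]]].
pose a (k : 'I_3) : R := if k == 0 then a0 else if k == 1 then a1 else a2.
have a_ge0 k : 0 <= a k by move: k; apply: ord3P.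
move=> yE d0 td; have [lt0 ltd] := ln_small d0 td; have /andP[t0 _] := td.
(* This is [t] to the power [a k / 2], so the [T] of [chord_curve] is [t] to the power
   [- (a i + a j)], whose logarithm to base [t] is the wanted coordinate. The factors 2 and 1/2
   there cost at most [ln 2 / (- ln t)]. *)
pose s k := expR (a k / 2 * ln t).
have s01 k : 0 < s k <= 1.
  by rewrite expR_gt0 -expR0 ler_expR mulr_ge0_le0 ?divr_ge0 // ltW.
exists (piGH (curve (fun k => (s k)%:C)%C)); set x := piGH _.
have E (i j : 'I_3) : (i < j)%N -> `|- (a i + a j) - ln (chord i j x) / ln t| < d.
  move=> ij; have /andP[] := chord_curve ij s01; rewrite -/x.
  set T := (_ ^+ 2)^-1 => lo up.
  have TE : T = expR (- (a i + a j) * ln t).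
    rewrite /T -expRD -expRM_natl -expRN; by congr expR; field.
  have T0 : 0 < T by rewrite TE expR_gt0.
  have lnT : ln T = - (a i + a j) * ln t by rewrite TE expRK.
  have c0 := chord_gt0 i j x.
  have up' : ln (chord i j x) <= ln 2 + ln T.
    by rewrite -lnM ?posrE // ler_ln ?posrE // mulr_gt0.
  have lo' : ln T - ln 2 <= ln (chord i j x).
    by rewrite -ln_div ?posrE // ler_ln ?posrE // divr_gt0.
  apply: le_lt_trans ltd.
  have -> : - (a i + a j) = ln T / ln t by rewrite lnT mulfK // lt_eqF.
  rewrite -mulrBl normrM normfV (ltr0_norm lt0) ler_pM2r ?invr_gt0 ?oppr_gt0 //.
  by rewrite ler_norml; apply/andP; split; lra.
apply/ball_rV3 => //; rewrite sLogE.
have [-> -> ->] := vec3E (ln (chord 0 1 x) / ln t) (ln (chord 0 2 x) / ln t)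
  (ln (chord 1 2 x) / ln t).
have := E 0 1 isT; have := E 0 2 isT; have := E 1 2 isT; rewrite /a /= => E12 E02 E01.
have -> : y = vec3 (- (a0 + a1)) (- (a0 + a2)) (- (a1 + a2)).
  by rewrite yE; apply/rowP; apply: ord3P; rewrite !mxE /=; ring.
by rewrite !mxE.
Qed.

End Cones.

Theorem mainTheorem6 (R : realType) :
  kuratowski_cvg (fun t : R => [set sLog t x | x in [set: GH R]])
    (realValuationCone R) /\
  realValuationCone R =
    cone3 (vec3 (-1) (-1) 0) (vec3 (-1) 0 (-1)) (vec3 0 (-1) (-1)).
Proof.
split; last exact: realValuationConeE.
rewrite realValuationConeE; split=> y.
  move=> /cone3_nbhsN [U Uy [d d0 hU]]; exists U => //.
  exists (expR (- (ln 2 / d))); first exact: expR_gt0.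
  move=> t td; rewrite -subset0 => _ [[x _ <-] /hU].
  by have [] := sLog_defect x d0 td => ? ? ?; case; rewrite leNgt => /negP.
move=> cy U /nbhs_ballP [d /= d0 yU].
exists (expR (- (ln 2 / d))); first exact: expR_gt0.
move=> t td; have [x yx] := sLog_dense cy d0 td.
by exists (sLog t x); split; [exists x | exact: yU].
Qed.
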